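(* Let $F:\mathbb{P}^2\dashrightarrow\mathbb{P}^2$ be the rational map $F([z_0:z_1:z_2])=[z_0(z_0^2-z_1^2-z_2^2): z_1^2z_2: z_2(z_0^2-z_2^2)]$, with extended indeterminacy set $E$ and Fatou set $\mathcal{F}(F)$, and let $p^c(A_\pi)$ be the projective resolvent set of $D_\infty$ with respect to its Koopman representation $\pi$. Then: (a) $\mathcal{F}(F)=p^c(A_\pi)\setminus E$; (b) the iteration sequence $\{F^{\circ n}\}$ converges normally on $\mathcal{F}(F)$ to the function $F_*([z_0:z_1:z_2])=[z_0:0:z_2+z_1f(z)]$, where $f(z)=\lim_{n\to\infty}f_n(z)$ and $$f_n(z)=\sum_{j=1}^{n-1}\frac{1}{2^j\prod_{k=0}^{j-1}T^{\circ k}(\tau(z))},\qquad n\ge 2,\ z\in p^c(A_\pi).$$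
   Context: $\mathbb{P}^2$ is the complex projective plane with the Fubini–Study metric; $\hat{\mathbb{C}}=\mathbb{C}\cup\{\infty\}$. ''Converges normally'' means uniformly on compact subsets. Koopman representation and projective resolvent set. $D_\infty=\langle a,t\mid a^2=t^2=1\rangle$ acts on the infinite rooted binary tree, whose boundary is $\partial T=\{0,1\}^{\mathbb{N}}$ with the uniform Bernoulli probability measure $\mu$, by $a(0w)=1w$, $a(1w)=0w$, $t(0w)=0\,a(w)$, $t(1w)=1\,t(w)$. The Koopman representation $\pi$ on $L^2(\partial T,\mu)$ is $(\pi(g)f)(x)=f(g^{-1}x)$. Put $A_\pi(z)=z_0I+z_1\pi(a)+z_2\pi(t)$, $p(A_\pi)=\{z\in\mathbb{P}^2\mid A_\pi(z)\text{ is not invertible}\}$ and $p^c(A_\pi)=\mathbb{P}^2\setminus p(A_\pi)$. It is known (Grigorchuk–Yang) that $p(A_\pi)=\bigcup_{-1\le x\le 1}\{z\in\mathbb{P}^2\mid z_0^2-z_1^2-z_2^2-2z_1z_2x=0\}$. The functions $T$ and $\tau$. $T(x)=2x^2-1$ on $\hat{\mathbb{C}}$, with $T(\infty)=\infty$, and $T^{\circ k}$ is its $k$-th iterate ($T^{\circ 0}$ is the identity). $\tau:\mathbb{P}^2\to\hat{\mathbb{C}}$ is defined by $\tau(z)=0$ if $z_0^2-z_1^2-z_2^2=0$, and $\tau(z)=\frac{z_0^2-z_1^2-z_2^2}{2z_1z_2}$ otherwise (value $\infty$ if $z_1z_2=0$). For $z\in p^c(A_\pi)$ one has $\tau(z)\in\hat{\mathbb{C}}\setminus[-1,1]$,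 and in $f_n$ the convention $1/\infty=0$ is used; the limit $f$ exists on $p^c(A_\pi)$. Indeterminacy. The indeterminacy set $I=I_1$ of $F$ is the set of points of $\mathbb{P}^2$ where the three coordinate polynomials of $F$ vanish simultaneously. For $n\ge1$, $I_n$ is the set of $p\in\mathbb{P}^2$ for which there is $1\le k\le n$ such that $p,F(p),\dots,F^{\circ(k-2)}(p)\notin I$ and $F^{\circ(k-1)}(p)\in I$. Let $I_\infty=\bigcup_{n\ge1}I_n$ and $E=\overline{I_\infty}$ (closure in the Fubini–Study metric). Fatou set. A point $p\in\mathbb{P}^2\setminus E$ is a Fatou point of $F$ if for every $\epsilon>0$ there is a neighborhood $U$ of $p$ with $\operatorname{diam}F^{\circ n}(U\setminus E)<\epsilon$ for all $n$ (diameter in the Fubini–Study metric). $\mathcal{F}(F)$ is the set of Fatou points. *)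

(* Defs.v *)
From HB Require Import structures.
From mathcomp Require Import all_boot all_order all_algebra.
From mathcomp Require Import all_classical all_reals all_analysis.
From mathcomp Require Import complex.
From mathcomp Require Import ring lra.

Set Implicit Arguments.
Unset Strict Implicit.
Unset Printing Implicit Defensive.
Import Order.TTheory GRing.Theory Num.Theory.
Import numFieldNormedType.Exports.
Local Open Scope classical_set_scope.
Local Open Scope ring_scope.

(* Points of the projective plane are the lines of C^3. *)
Definition P2 (R : realType) : Type :=
  {L : {vspace 'rV[R[i]]_3} | \dim L == 1%N}.

HB.instance Definition _ (R : realType) := SubChoice.on (P2 R).

Lemma acos_triangle (R : realType) (x y w z : R) :
  0 <= x <= 1 -> 0 <= y <= 1 -> 0 <= w <= 1 -> 0 <= z ->
  z ^+ 2 <= (1 - x ^+ 2) * (1 - y ^+ 2) -> x * y <= w + z ->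
  acos w <= acos x + acos y.
Proof.
have N11 (s : R) : 0 <= s <= 1 -> -1 <= s <= 1 by move=> /andP[? ?]; lra.
move=> x01 y01 w01 z0 z2 xyz.
have [|lepi] := leP pi (acos x + acos y).
  by apply: le_trans; rewrite acos_lepi ?N11.
have wI : acos w \in `[0, pi] by rewrite in_itv/= acos_ge0 ?acos_lepi ?N11.
have xyI : acos x + acos y \in `[0, pi].
  by rewrite in_itv/= (ltW lepi) addr_ge0 ?acos_ge0 ?N11.
rewrite leNgt -(ltr_cos xyI wI) -leNgt cosD !sin_acos ?N11//.
rewrite !acosK ?in_itv/= ?N11// lerBlDr (le_trans xyz)// lerD2l.
rewrite -sqrtrM; last by rewrite subr_ge0 expr_le1 //; case/andP: x01.
by rewrite -(ger0_norm z0) -sqrtr_sqr ler_wsqrtr.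
Qed.

Section proj.
Context {R : realType}.
Implicit Types (v : 'rV[R[i]]_3) (p q r : P2 R).

(* Some homogeneous coordinates of [p]. *)
Definition coords p : 'rV[R[i]]_3 := vpick (val p).

Lemma coords_neq0 p : coords p != 0.
Proof.
rewrite /coords vpick0 -dimv_eq0.
by rewrite (eqP (valP p)).
Qed.

Lemma val_coords p : val p = <[coords p]>%VS.
Proof.
apply/eqP; rewrite eq_sym eqEdim; apply/andP; split.
  by rewrite -memvE memv_pick.
by rewrite (eqP (valP p)) dim_vline coords_neq0.
Qed.

Fact proj_default_subproof : \dim <[const_mx 1 : 'rV[R[i]]_3]>%VS == 1%N.
Proof.
rewrite dim_vline; suff -> : (const_mx 1 : 'rV[R[i]]_3) != 0 by [].
by apply/eqP => /rowP /(_ 0)/eqP; rewrite !mxE oner_eq0.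
Qed.

(* [z_0 : z_1 : z_2]; the zero vector is sent to a junk point. *)
Definition proj v : P2 R :=
  insubd (exist _ <[const_mx 1]>%VS proj_default_subproof : P2 R) <[v]>%VS.

Lemma val_proj v : v != 0 -> val (proj v) = <[v]>%VS.
Proof. by move=> v0; rewrite /proj insubdK// -topredE/= dim_vline v0. Qed.

Lemma coords_proj v : v != 0 -> exists2 c, c != 0 & coords (proj v) = c *: v.
Proof.
move=> v0; have /vlineP[c cE] : coords (proj v) \in <[v]>%VS.
  by rewrite -val_proj// /coords memv_pick.
exists c => //; apply: contraNneq (coords_neq0 (proj v)) => c0.
by rewrite cE c0 scale0r.
Qed.

Lemma projZ c v : c != 0 -> proj (c *: v) = proj v.
Proof.
move=> c0; rewrite /proj; congr insubd; apply/eqP; rewrite eqEsubv -!memvE.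
rewrite memvZ ?memv_line//=; apply/vlineP; exists c^-1.
by rewrite scalerA mulVf// scale1r.
Qed.

(* The Fubini-Study distance, arccos (|<u, v>| / (|u| |v|)). *)
Definition fs_cos p q : R :=
  complex.Re (`|dotmx (coords p) (coords q)| /
    (sqrtC (dotmx (coords p) (coords p)) * sqrtC (dotmx (coords q) (coords q)))).

Definition fs_dist p q : R := acos (fs_cos p q).

Let unit p := (sqrtC (dotmx (coords p) (coords p)))^-1 *: coords p.

Let norm_gt0 p : 0 < sqrtC (dotmx (coords p) (coords p)).
Proof. by rewrite sqrtC_gt0 dnorm_gt0 coords_neq0. Qed.

Let dotZ a b (u v : 'rV[R[i]]_3) : dotmx (a *: u) (b *: v) = a * (b^* * dotmx u v).
Proof. by rewrite linearZl_LR/= linearZr_LR. Qed.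

Let fs_cosE p q : fs_cos p q = complex.Re `|dotmx (unit p) (unit q)|.
Proof.
have nE (x y n : R[i]) : 0 < x -> 0 < y ->
    `|n| / (x * y) = `|x^-1 * (y^-1^* * n)|.
  move=> x0 y0; rewrite !normrM norm_conjC !normfV (gtr0_norm x0) (gtr0_norm y0).
  by rewrite invfM mulrC mulrA.
by rewrite /fs_cos dotZ (nE _ _ _ (norm_gt0 p) (norm_gt0 q)).
Qed.

Let dotC (u v : 'rV[R[i]]_3) : dotmx u v = (dotmx v u)^*.
Proof. by rewrite hermC/= expr0 mul1r. Qed.

Let dotCS (u v : 'rV[R[i]]_3) :
  `|dotmx u v| ^+ 2 <= dotmx u u * dotmx v v ?= iff ~~ free [:: u; v].
Proof. exact: CauchySchwarz. Qed.

Let unit1 p : dotmx (unit p) (unit p) = 1.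
Proof.
rewrite /unit dotZ geC0_conj; last by rewrite invr_ge0 ltW.
rewrite mulrA -invfM -expr2 sqrtCK mulVf// gt_eqF//.
by rewrite dnorm_gt0 coords_neq0.
Qed.

Let ReC (x : R[i]) : 0 <= x -> (complex.Re x)%:C%C = x.
Proof. by move=> x0; rewrite RRe_real// ger0_real. Qed.

Let Re_norm (x : R[i]) : (complex.Re `|x|)%:C%C = `|x|.
Proof. exact: ReC. Qed.

Let unit_gram (u v w : 'rV[R[i]]_3) (x y t : R[i]) :
  dotmx u u = 1 -> dotmx v v = 1 -> dotmx w w = 1 ->
  `|dotmx u v| = x -> `|dotmx v w| = y -> `|dotmx u w| = t ->
  exists z, [/\ 0 <= z,
    z ^+ 2 <= (1 - x ^+ 2) * (1 - y ^+ 2) & x * y <= t + z].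
Proof.
move=> u1 v1 w1 <- <- <-.
have [a aE] : exists a, dotmx u v = a by exists (dotmx u v).
have [b bE] : exists b, dotmx w v = b by exists (dotmx w v).
rewrite (dotC v w) norm_conjC aE bE.
pose u' := u - a *: v; pose w' := w - b *: v.
have dB (k l : 'rV[R[i]]_3) c d : dotmx v v = 1 ->
    dotmx (k - c *: v) (l - d *: v) =
    dotmx k l - d^* * dotmx k v - (c * (dotmx l v)^* - c * d^*).
  move=> {}v1; rewrite linearBl/= !linearBr/= !dotZ.
  rewrite linearZr_LR/= linearZl_LR/= v1 mulr1.
  by rewrite (dotC v l).
have du' : dotmx u' u' = 1 - `|a| ^+ 2.
  by rewrite (dB _ _ _ _ v1) u1 aE normCK subrr subr0 mulrC.
have dw' : dotmx w' w' = 1 - `|b| ^+ 2.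
  by rewrite (dB _ _ _ _ v1) w1 bE normCK subrr subr0 mulrC.
have duw : dotmx u' w' = dotmx u w - a * b^*.
  by rewrite (dB _ _ _ _ v1) aE bE subrr subr0 mulrC.
exists `|dotmx u' w'|; split; first exact: normr_ge0.
  rewrite -du' -dw'.
  by case: (dotCS u' w').
rewrite -(norm_conjC b) -normrM.
have -> : a * b^* = dotmx u w - dotmx u' w'.
  by rewrite duw opprB addrC subrK.
exact: ler_normB.
Qed.

Lemma fs_cos01 p q : 0 <= fs_cos p q <= 1.
Proof.
rewrite fs_cosE; apply/andP; split.
  by have := normr_ge0 (dotmx (unit p) (unit q)); rewrite -Re_norm ler0c.
have [+ _] := dotCS (unit p) (unit q).
by rewrite !unit1 mulr1 expr_le1// -(lecR _ 1) Re_norm.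
Qed.

Let fs_cosC p q : fs_cos p q = fs_cos q p.
Proof. by rewrite !fs_cosE (dotC (unit p)) norm_conjC. Qed.

Let fs_cosxx p : fs_cos p p = 1.
Proof. by rewrite fs_cosE unit1 normr1. Qed.

Let fs_cos_N11 p q : -1 <= fs_cos p q <= 1.
Proof.
by have /andP[p0 ->] := fs_cos01 p q; rewrite andbT (le_trans _ p0)// lerN10.
Qed.

Let fs_dist_itv p q : 0 <= fs_dist p q <= pi.
Proof. by rewrite /fs_dist acos_ge0 ?acos_lepi. Qed.

Let fs_distK p q : cos (fs_dist p q) = fs_cos p q.
Proof. by rewrite /fs_dist acosK// in_itv/=. Qed.

Fact fs_distxx p : fs_dist p p = 0.
Proof. by rewrite /fs_dist fs_cosxx acos1. Qed.

Fact fs_dist_sym p q : fs_dist p q = fs_dist q p.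
Proof. by rewrite /fs_dist fs_cosC. Qed.

Fact fs_dist_pos p q : fs_dist p q = 0 -> p = q.
Proof.
move=> pq0; have : fs_cos p q = 1 by rewrite -fs_distK pq0 cos0.
rewrite fs_cosE => c1.
have n1 : `|dotmx (unit p) (unit q)| = 1 by rewrite -Re_norm c1.
have [_] := dotCS (unit p) (unit q).
rewrite n1 !unit1 mulr1 expr1n eqxx => /esym.
have u0 r : unit r != 0.
  by rewrite scaler_eq0 negb_or coords_neq0 invr_eq0 gt_eqF.
rewrite free_cons span_seq1 seq1_free u0 andbT negbK => /vlineP[k pkq].
have line r : val r = <[unit r]>%VS.
  rewrite val_coords; apply/eqP; rewrite eqEsubv -!memvE; apply/andP; split.
    apply/vlineP; exists (sqrtC (dotmx (coords r) (coords r))).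
    by rewrite /unit scalerA mulfV ?scale1r// gt_eqF.
  exact: memvZ (memv_line _).
apply/val_inj/eqP; rewrite eqEdim (eqP (valP p)) (eqP (valP q)) leqnn andbT.
rewrite (line p) (line q) -memvE pkq.
exact: memvZ (memv_line _).
Qed.

Let unit_gramR (u v w : 'rV[R[i]]_3) (x y t : R) :
  dotmx u u = 1 -> dotmx v v = 1 -> dotmx w w = 1 ->
  `|dotmx u v| = x%:C%C -> `|dotmx v w| = y%:C%C -> `|dotmx u w| = t%:C%C ->
  exists z : R, [/\ 0 <= z,
    z ^+ 2 <= (1 - x ^+ 2) * (1 - y ^+ 2) & x * y <= t + z].
Proof.
move=> u1 v1 w1 uvx vwy uwt.
have [z [z0]] := unit_gram u1 v1 w1 uvx vwy uwt.
have [Z zE] : exists Z, z = Z%:C%C by exists (complex.Re z); rewrite (ReC z0).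
move: z0; rewrite {}zE ler0c => z0.
rewrite -(rmorphM (real_complex R)) -(rmorphD (real_complex R)) lecR.
rewrite -!(rmorphXn (real_complex R)) -(rmorph1 (real_complex R)).
rewrite -!(rmorphB (real_complex R)) -(rmorphM (real_complex R)) lecR.
by move=> z2 xyz; exists Z.
Qed.

Fact fs_dist_triangle q p r : fs_dist p r <= fs_dist p q + fs_dist q r.
Proof.
have nE s t : `|dotmx (unit s) (unit t)| = (fs_cos s t)%:C%C.
  by rewrite fs_cosE Re_norm.
have [z [z0 z2 xyz]] := unit_gramR (unit1 p) (unit1 q) (unit1 r)
  (nE p q) (nE q r) (nE p r).
exact: acos_triangle (fs_cos01 p q) (fs_cos01 q r) (fs_cos01 p r) z0 z2 xyz.
Qed.
End proj.

HB.instance Definition _ (R : realType) := isMetric.Build R (P2 R)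
  (@fs_distxx R) (@fs_dist_pos R) (@fs_dist_sym R) (@fs_dist_triangle R).

Section ProjectiveMap.
Context {R : realType}.
Implicit Types (p : P2 R) (z : 'rV[R[i]]_3).

Definition row3 (a b c : R[i]) : 'rV[R[i]]_3 := \row_(j < 3) [:: a; b; c]`_j.

Definition qform z : R[i] := z 0 0 ^+ 2 - z 0 1 ^+ 2 - z 0 2 ^+ 2.

Definition Fpoly z : 'rV[R[i]]_3 :=
  row3 (z 0 0 * qform z) (z 0 1 ^+ 2 * z 0 2) (z 0 2 * (z 0 0 ^+ 2 - z 0 2 ^+ 2)).

(* The rational map, extended to the indeterminacy set by the junk value
   [proj 0]; orbits are only inspected up to their first visit to [indet]. *)
Definition Fmap p : P2 R := proj (Fpoly (coords p)).

Definition indet : set (P2 R) := [set p | Fpoly (coords p) = 0].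

Lemma FpolyZ (c : R[i]) z : Fpoly (c *: z) = c ^+ 3 *: Fpoly z.
Proof.
apply/rowP => j; rewrite !mxE /qform !mxE.
by case: j => [[|[|[|//]]]] /= _; ring.
Qed.

Lemma Fmap_proj z : z != 0 -> Fmap (proj z) = proj (Fpoly z).
Proof.
move=> z0; rewrite /Fmap; have [c c0 ->] := coords_proj z0.
by rewrite FpolyZ projZ// expf_neq0.
Qed.

Lemma indet_proj z : z != 0 -> indet (proj z) <-> Fpoly z = 0.
Proof.
move=> z0; rewrite /indet/=; have [c c0 ->] := coords_proj z0.
rewrite FpolyZ; split => [/eqP|->]; last by rewrite scaler0.
by rewrite scaler_eq0 expf_eq0 (negbTE c0) andbF => /eqP.
Qed.

Definition indet_n (n : nat) : set (P2 R) :=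
  [set p | exists k, [/\ (1 <= k <= n)%N,
    forall j, (j.+1 < k)%N -> ~ indet (iter j Fmap p) & indet (iter k.-1 Fmap p)]].

Definition indet_infty : set (P2 R) :=
  \bigcup_(n in [set n | (1 <= n)%N]) indet_n n.

Definition ext_indet : set (P2 R) := closure indet_infty.

Definition diam (A : set (P2 R)) : \bar R :=
  ereal_sup [set (mdist x.1 x.2)%:E | x in A `*` A].

Definition Fatou : set (P2 R) :=
  [set p | ~ ext_indet p /\ forall e : R, 0 < e ->
    exists2 U, nbhs p U &
      forall n, (diam (iter n Fmap @` (U `\` ext_indet)) < e%:E)%E].

End ProjectiveMap.
Arguments ext_indet R : clear implicits.
Arguments Fatou R : clear implicits.

(* [false] and [true] stand for the letters 0 and 1. *)
Definition cylinder (s : seq bool) : set (nat -> bool) :=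
  [set x | forall i, (i < size s)%N -> x i = nth false s i].

(* The sigma-algebra generated by the cylinders is the Borel sigma-algebra. *)
Definition boundary : Type := g_sigma_algebraType (range cylinder).
HB.instance Definition _ := Measurable.on boundary.

Definition shift (x : nat -> bool) : nat -> bool := fun n => x n.+1.

Definition act_a (x : boundary) : boundary :=
  fun n => if n is 0 then ~~ x 0 else x n.

(* t(0w) = 0 a(w) and t(1w) = 1 t(w), computed letter by letter. *)
Fixpoint act_t_fix (x : nat -> bool) (n : nat) : bool :=
  if n is n'.+1 then
    if x 0 then act_t_fix (shift x) n' else act_a (shift x) n'
  else x 0.
Definition act_t (x : boundary) : boundary := act_t_fix x.

Lemma act_aK : involutive act_a.
Proof. by move=> x; apply/funext => -[|n] //=; rewrite negbK. Qed.

Lemma act_tK : involutive act_t.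
Proof.
move=> x; apply/funext => n; rewrite /act_t; elim: n x => //= n IH x.
case: ifP => x0.
  rewrite -[RHS](IH (shift x)); congr (act_t_fix _ n).
  by apply/funext => m; rewrite /shift/= x0.
rewrite -[RHS]/(shift x n) -[in RHS](act_aK (shift x)); congr (act_a _ n).
by apply/funext => m; rewrite /shift/= x0.
Qed.

Section Koopman.
Context {R : realType} (mu : probability boundary R).
Implicit Types (f g : boundary -> R[i]) (p : P2 R).

Definition uniform_bernoulli : Prop :=
  forall s, mu (cylinder s) = (2^-1 ^+ size s)%:E.

(* L^2 is handled through representatives: functions are square-integrable
   and all identities between them hold almost everywhere. *)
Definition L2 : set (boundary -> R[i]) :=
  [set f | ((fun x => complex.Re (f x)) \in Lfun mu 2%:E) /\
           ((fun x => complex.Im (f x)) \in Lfun mu 2%:E)].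

Definition L2norm f : \bar R :=
  Lnorm mu 2%:E (fun x => (complex.Re `|f x|)%:E).

(* (pi(g) f)(x) = f(g^{-1} x), where a^{-1} = a and t^{-1} = t by [act_aK] and
   [act_tK]. *)
Definition pi_a f := f \o act_a.
Definition pi_t f := f \o act_t.

Definition Api (z : 'rV[R[i]]_3) f : boundary -> R[i] :=
  fun x => z 0 0 * f x + z 0 1 * pi_a f x + z 0 2 * pi_t f x.

(* Linearity and boundedness make [B] compatible with a.e. equality. *)
Definition bounded_operator (B : (boundary -> R[i]) -> boundary -> R[i]) :=
  [/\ forall f, L2 f -> L2 (B f),
      forall (c : R[i]) f g, L2 f -> L2 g ->
        B (fun x => c * f x + g x) = (fun x => c * B f x + B g x) %[ae mu] &
      exists M : R, forall f, L2 f -> (L2norm (B f) <= M%:E * L2norm f)%E].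

Definition invertible (A : (boundary -> R[i]) -> boundary -> R[i]) : Prop :=
  exists2 B, bounded_operator B & forall f, L2 f ->
    A (B f) = f %[ae mu] /\ B (A f) = f %[ae mu].

Definition proj_spectrum : set (P2 R) :=
  [set p | ~ invertible (Api (coords p))].

Definition proj_resolvent : set (P2 R) := ~` proj_spectrum.

End Koopman.

Section LimitMap.
Context {R : realType}.
(* The Riemann sphere, with [None] as the point at infinity. *)
Local Notation Chat := (one_point_compactification R[i]).

Definition tau (p : P2 R) : Chat :=
  let z := coords p in
  if qform z == 0 then Some 0
  else if z 0 1 * z 0 2 == 0 then None
  else Some (qform z / (2 * z 0 1 * z 0 2)).

Lemma tau_proj z : z != 0 -> tau (proj z) =
  if qform z == 0 then Some 0
  else if z 0 1 * z 0 2 == 0 then None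
  else Some (qform z / (2 * z 0 1 * z 0 2)).
Proof.
move=> z0; rewrite /tau; have [c c0 ->] := coords_proj z0.
have qZ : qform (c *: z) = c ^+ 2 * qform z by rewrite /qform !mxE; ring.
rewrite qZ !mxE mulf_eq0 expf_eq0 (negbTE c0)/=; case: ifP => // _.
have -> : c * z 0 1 * (c * z 0 2) = c ^+ 2 * (z 0 1 * z 0 2) by ring.
rewrite mulf_eq0 expf_eq0 (negbTE c0)/=; case: ifP => // /negbT.
rewrite mulf_eq0 negb_or => /andP[z1 z2]; congr Some.
by field; rewrite c0 z1 z2.
Qed.

Definition chebT (x : Chat) : Chat := omap (fun c => 2 * c ^+ 2 - 1) x.

(* The product 0 * oo, set to oo here, does not occur on the resolvent set:
   there tau avoids [-1, 1], hence so do its iterates under [chebT]. *)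
Definition hmul (x y : Chat) : Chat :=
  if (x, y) is (Some a, Some b) then Some (a * b) else None.

(* 1 / oo = 0; the junk value 0^-1 = 0 does not occur on the resolvent set. *)
Definition hinv (x : Chat) : R[i] := if x is Some c then c^-1 else 0.

Definition fseq (p : P2 R) (n : nat) : R[i] :=
  \sum_(1 <= j < n)
    hinv (hmul (Some (2 ^+ j)) (\big[hmul/Some 1]_(0 <= k < j) iter k chebT (tau p))).

(* [R[i]^o] gives access to the usual topology of the complex plane. *)
Definition flim (p : P2 R) : R[i] := limn (fseq p : nat -> R[i]^o).

Definition Fstar_coords (p : P2 R) : 'rV[R[i]]_3 :=
  let z := coords p in row3 (z 0 0) 0 (z 0 2 + z 0 1 * flim p).

(* Meaningful where [Fstar_coords p != 0]. *)
Definition Fstar (p : P2 R) : P2 R := proj (Fstar_coords p).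
End LimitMap.

(* Main.v *)
From HB Require Import structures.
Require Import Defs.
From mathcomp Require Import all_boot all_order all_algebra.
From mathcomp Require Import all_classical all_reals all_analysis complex.
From mathcomp Require Import measurable_realfun ring lra zify.

(** Write a point of the projective plane as z, put Q = z0^2 - z1^2 - z2^2 and let s be a root of
s Q = (1 + s^2) z1 z2, so that tau = (s + 1/s) / 2, the value s = 0 standing for tau = oo. The
roots are s and 1/s. Hence every z falls under one of two cases: |s| < 1 for one of the roots,
or |s| = 1, the latter being the case tau in [-1, 1] (joukowski_dichotomy). When Q = z1 z2 = 0
every s is a root, and z is counted in the second case.

In the coordinate s the map F is explicit. Removing the common factor Q / (1 + s^2), F becomes
z |-> ((1 + s^2) z0, s z1, (1 + s^2) z2 + s z1) and s becomes s^2, which is the semiconjugacy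
of F with T. Iterating, with N = 2^n,
  F^n(z) = [z0 (1 - s^(2N)) : z1 s^(N-1) (1 - s^2) : z2 (1 - s^(2N)) + z1 (s - s^(2N-1))]
(iter_joukowski), and f_(n+1) = (s - s^(2N-1)) / (1 - s^(2N)), so that f = s when |s| < 1
(fseq_closed). Thus F^n tends to F_* = [z0 : 0 : z2 + z1 s] wherever |s| < 1, locally uniformly,
provided that no orbit meets the indeterminacy set and that F_* is defined.

Both provisos, and the whole remaining part of the plane, are absorbed by E. The points
  [s^(N-1) (1 - s^2) : 1 - s^(2N) : s^(2N-1) - s]
are mapped by F^n to [1 : 1 : 0], unless an earlier iterate is indeterminate; either way they
lie in I_oo (indet_curve_infty). Letting N grow with |s| < 1 fixed shows that [0 : 1 : -s] is in
E for |s| <= 1; those with |s| < 1 are the points of the first case where F_* is not defined.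
Letting N grow while s^N = w is fixed and s tends to a point of the unit circle, the limits fill,
up to closure, all conics tau = x with x in [-1, 1] (ext_indet_spec). So a point off E has
|s| < 1 and a well-defined image under F_* (not_ext_indet); convergence to the continuous map
F_* near such a point gives equicontinuity, and the Fatou set is exactly the complement of E
(FatouE).

There remains the resolvent set, to be compared with |s| < 1. With A' = z0 - z1 a - z2 t and
u = a t, one has A A' = A' A = Q - z1 z2 (u + u^-1), a nonzero multiple of
(1 - s u) (1 - s u^-1). If |s| < 1 this is inverted by Neumann series, whose a.e. convergence on
representatives follows by integrating the series of r^k |f o phi^k|^2 (invertible_neumann,
Api_invertible). If |s| = 1, the self-similarity of the action gives unimodular eigenfunctions
of u for all dyadic roots of unity t. Applied to them, an inverse of A would bound |t - 1/t|^2
by a constant times |s + 1/s - t - 1/t|^2, by density for all t on the circle, which fails for t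
close to s (Api_not_invertible). So the resolvent set is the region |s| < 1, it contains the
complement of E, and the series for f converges on it. *)

Set Implicit Arguments.
Unset Strict Implicit.
Unset Printing Implicit Defensive.
Import Order.TTheory GRing.Theory Num.Theory.
Import numFieldNormedType.Exports.
Local Open Scope classical_set_scope.
Local Open Scope ring_scope.
Local Notation proj := Defs.proj.
Local Notation shift := Defs.shift.

(** * Limits in a numeric field, written pointwise *)

Section FieldLimits.
Context {K : numFieldType} {T : Type} {F : set_system T} {FF : Filter F}.
Implicit Types (f g : T -> K^o) (a b : K^o).

Lemma kcvgM f g a b : f @ F --> a -> g @ F --> b ->
  (fun t => f t * g t : K^o) @ F --> (a * b : K^o).
Proof. exact: cvgM. Qed.

Lemma kcvgD f g a b : f @ F --> a -> g @ F --> b ->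
  (fun t => f t + g t : K^o) @ F --> (a + b : K^o).
Proof. exact: cvgD. Qed.

Lemma kcvgB f g a b : f @ F --> a -> g @ F --> b ->
  (fun t => f t - g t : K^o) @ F --> (a - b : K^o).
Proof. exact: cvgB. Qed.

Lemma kcvg_cst a : (fun=> a) @ F --> a.
Proof. exact: cvg_cst. Qed.

Lemma kcvgX f a n : f @ F --> a -> (fun t => f t ^+ n : K^o) @ F --> (a ^+ n : K^o).
Proof.
move=> fa; elim: n => [|n IH]; first by under eq_fun do rewrite expr0; exact: cvg_cst.
by under eq_fun do rewrite exprS; rewrite exprS; apply: kcvgM.
Qed.

Lemma kcvgV f a : a != 0 -> f @ F --> a -> (fun t => (f t)^-1 : K^o) @ F --> (a^-1 : K^o).
Proof. exact: cvgV. Qed.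

Lemma kcvg_norm f a : f @ F --> a -> (fun t => `|f t| : K^o) @ F --> (`|a| : K^o).
Proof. exact: cvg_norm. Qed.

Lemma kcvg_sum (I : Type) (r : seq I) (f : I -> T -> K^o) (a : I -> K^o) :
  (forall i, f i @ F --> a i) ->
  (fun t => \sum_(i <- r) f i t : K^o) @ F --> (\sum_(i <- r) a i : K^o).
Proof.
move=> fa; elim: r => [|i r IH].
  by under eq_fun do rewrite big_nil; rewrite big_nil; exact: cvg_cst.
by under eq_fun do rewrite big_cons; rewrite big_cons; exact: kcvgD.
Qed.

Lemma kcvgP f a : f @ F --> a <->
  forall e : K, 0 < e -> \forall t \near F, `|f t - a| < e.
Proof.
split=> [fa e e0|fa]; last by apply/cvgrPdistC_lt => e e0; exact: fa.
by move/cvgrPdistC_lt : fa => /(_ _ e0).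
Qed.

Lemma kcvg_near f g a : (\forall t \near F, f t = g t) -> f @ F --> a -> g @ F --> a.
Proof. by move=> fg; apply: cvg_trans; exact: near_eq_cvg. Qed.

End FieldLimits.
Arguments kcvg_cst {K T F FF} a.

(** * Convergence in the projective plane *)

Section Metric.
Context {R : realType}.
Local Notation C := R[i]^o.
Implicit Types (u v w : 'rV[R[i]]_3) (p q : P2 R).

Lemma cpos_real (e : R[i]) : 0 < e -> exists2 d : R, 0 < d & e = d%:C%C.
Proof. by case: e => x y; rewrite ltcE /= => /andP[/eqP-> x0]; exists x. Qed.

Lemma dotmx_sum u v : dotmx u v = \sum_j u 0 j * (v 0 j)^*.
Proof. by rewrite dotmxE mxE; apply: eq_bigr => j _; rewrite !mxE. Qed.

Lemma dotmxC u v : dotmx u v = (dotmx v u)^*.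
Proof. by rewrite hermC/= expr0 mul1r. Qed.

Lemma dotmxZZ (a b : R[i]) u v : dotmx (a *: u) (b *: v) = a * b^* * dotmx u v.
Proof. by rewrite linearZl_LR/= linearZr_LR/= mulrA. Qed.

Lemma proj_surj p : exists2 v, v != 0 & p = proj v.
Proof.
exists (coords p); first exact: coords_neq0.
by apply/val_inj; rewrite val_proj ?coords_neq0// val_coords.
Qed.

Lemma proj_coords p : proj (coords p) = p.
Proof. by apply/val_inj; rewrite val_proj ?coords_neq0// val_coords. Qed.

Lemma Re_norm_div_sqrt (n x y : R[i]) : 0 <= x -> 0 <= y ->
  ((complex.Re (`|n| / (sqrtC x * sqrtC y))) ^+ 2)%:C%C = `|n| ^+ 2 / (x * y).
Proof.
move=> x0 y0; rewrite rmorphXn/= RRe_real.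
  by rewrite expr_div_n exprMn !sqrtCK.
apply: ger0_real; apply: divr_ge0; first exact: normr_ge0.
by apply: mulr_ge0; rewrite sqrtC_ge0.
Qed.

(** Squaring removes the square roots from the cosine of the Fubini-Study distance, so that its
limits can be computed from those of the entries. *)
Lemma fs_cos_sqr v w : v != 0 -> w != 0 ->
  ((fs_cos (proj v) (proj w)) ^+ 2)%:C%C =
  `|dotmx v w| ^+ 2 / (dotmx v v * dotmx w w).
Proof.
move=> v0 w0; rewrite /fs_cos.
have [c c0 ->] := coords_proj v0; have [d d0 ->] := coords_proj w0.
have dv0 : 0 < dotmx v v by rewrite dnorm_gt0.
have dw0 : 0 < dotmx w w by rewrite dnorm_gt0.
have cv0 : 0 <= dotmx (c *: v) (c *: v) by apply: dnorm_ge0.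
have dw0' : 0 <= dotmx (d *: w) (d *: w) by apply: dnorm_ge0.
rewrite (Re_norm_div_sqrt _ cv0 dw0') !dotmxZZ; clear cv0 dw0'.
move: (dotmx v w) (dotmx v v) (dotmx w w) dv0 dw0 => x y z; clear v0 w0 v w.
move=> /lt0r_neq0 y0 /lt0r_neq0 z0.
rewrite !normrM norm_conjC -!normCK !exprMn.
have nc : `|c| != 0 by rewrite normr_eq0.
have nd : `|d| != 0 by rewrite normr_eq0.
move: (`|c|) (`|d|) (`|x|) nc nd => c' d' x' nc nd; clear c0 d0 c d.
by field; rewrite nc nd y0 z0.
Qed.

Lemma ler_cos : {in `[0, pi] &, {mono (@cos R) : x y /~ y <= x}}.
Proof. by move=> x y xI yI; rewrite !leNgt ltr_cos. Qed.

(** The arccosine is not differentiable at 1; as cos^2 <= cos on [0, 1], it suffices to compare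
with cos e and to use that the cosine decreases. *)
Lemma near_fs_cos (T : Type) (F : set_system T) (FF : Filter F) (f : T -> P2 R) p :
  (fun t => ((fs_cos (f t) p) ^+ 2)%:C%C : C) @ F --> (1 : C) -> f @ F --> p.
Proof.
move=> f1; apply/cvg_ballP => e e0; rewrite near_map.
wlog epi : e e0 / e <= pi.
  move=> H; have [|/ltW pie] := leP e pi; first exact: H.
  have := H pi (pi_gt0 R) (lexx _); apply: filterS => t; exact: le_ball.
have ce1 : cos e < 1 by rewrite -(@cos0 R) ltr_cos// in_itv/= ?lexx ?(pi_ge0 R)// ltW.
have d0 : 0 < (1 - cos e)%:C%C :> R[i] by rewrite ltcR subr_gt0.
move/kcvgP : f1 => /(_ _ d0); apply: filterS => t.
rewrite -[1 : R[i]]/(1%:C%C) -rmorphB normc_def/= expr0n/= addr0 sqrtr_sqr ltcR => H.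
rewrite ballEmdist/= metric_sym -[mdist _ _]/(fs_dist (f t) p) /fs_dist.
have /andP[c0 c1] := fs_cos01 (f t) p.
have cN : -1 <= fs_cos (f t) p <= 1 by rewrite c1 andbT (le_trans _ c0)// lerN10.
rewrite ltNge; apply/negP => ea.
have : fs_cos (f t) p <= cos e.
  rewrite -[fs_cos _ _]acosK ?in_itv//= ler_cos// in_itv/= ?ea ?acos_ge0 ?acos_lepi//.
  by rewrite epi ltW.
apply/negP; rewrite -ltNge.
have : 1 - cos e > 1 - fs_cos (f t) p ^+ 2.
  by apply: le_lt_trans H; rewrite distrC ler_norm.
have : fs_cos (f t) p ^+ 2 <= fs_cos (f t) p by rewrite expr2 ler_piMr.
by lra.
Qed.

Lemma cvg_proj (T : Type) (F : set_system T) (FF : Filter F)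
    (v : T -> 'rV[R[i]]_3) (v0 : 'rV[R[i]]_3) :
  v0 != 0 -> (forall j, (fun t => v t 0 j : C) @ F --> (v0 0 j : C)) ->
  (fun t => proj (v t)) @ F --> proj v0.
Proof.
move=> v00 vv; apply: near_fs_cos.
have dd : (fun t => dotmx (v t) (v t) : C) @ F --> (dotmx v0 v0 : C).
  have -> : (fun t => dotmx (v t) (v t) : C) = (fun t => \sum_j `|v t 0 j| ^+ 2 : C).
    by apply/funext => t; rewrite dotmx_sum; apply: eq_bigr => j _; rewrite normCK.
  have -> : dotmx v0 v0 = \sum_j `|v0 0 j| ^+ 2.
    by rewrite dotmx_sum; apply: eq_bigr => j _; rewrite normCK.
  by apply: kcvg_sum => j; apply: kcvgX; apply: kcvg_norm.
have de : (fun t => dotmx (v t) v0 : C) @ F --> (dotmx v0 v0 : C).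
  under eq_fun do rewrite dotmx_sum; rewrite dotmx_sum.
  by apply: kcvg_sum => j; exact: (kcvgM (vv j) (kcvg_cst ((v0 0 j)^*))).
have d0 : 0 < dotmx v0 v0 by rewrite dnorm_gt0.
have vn0 : \forall t \near F, v t != 0.
  move/kcvgP : dd => /(_ _ d0); apply: filterS => t; apply: contraTneq => ->.
  by rewrite linear0l sub0r normrN ger0_norm ?ltxx// ltW.
have -> : (1 : C) = `|dotmx v0 v0| ^+ 2 / (dotmx v0 v0 * dotmx v0 v0).
  by rewrite ger0_norm ?ltW// -expr2 divff// expf_neq0// gt_eqF.
have nz : dotmx v0 v0 * dotmx v0 v0 != 0 by rewrite mulf_neq0// gt_eqF.
have lim := kcvgM (kcvgX (n:=2) (kcvg_norm de)) (kcvgV nz (kcvgM dd (kcvg_cst (dotmx v0 v0)))).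
apply: kcvg_near; last exact: lim.
 apply: filterS vn0 => t vt.
by rewrite fs_cos_sqr.
Qed.

Lemma sqr_coord_le v j : `|v 0 j| ^+ 2 <= dotmx v v.
Proof.
rewrite dotmx_sum (bigD1 j)//= -normCK lerDl; apply: sumr_ge0 => i _.
by rewrite -normCK exprn_ge0.
Qed.

Lemma dotmxB_proj v w : dotmx w v = dotmx v v ->
  dotmx (w - v) (w - v) = dotmx w w - dotmx v v.
Proof.
move=> wv; have vw : dotmx v w = dotmx v v by rewrite dotmxC wv [RHS]dotmxC.
rewrite linearBl/= !linearBr/= wv vw.
by move: (dotmx w w) (dotmx v v); clear => a b; rewrite subrr subr0.
Qed.

Lemma lt_normc (x : R[i]) (d : R) : 0 < d -> `|x| ^+ 2 < (d ^+ 2)%:C%C -> `|x| < d%:C%C.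
Proof.
move=> d0; have dC : 0 <= d%:C%C :> R[i] by rewrite ler0c ltW.
by rewrite rmorphXn/= ltr_pXn2r// nnegrE.
Qed.

Lemma acos_lt_sqr (b : R) : b < 1 -> exists2 r : R, 0 < r &
  forall c, 0 <= c <= 1 -> acos c < r -> b < c ^+ 2.
Proof.
move=> b1; have [r r0 [br r2]] : exists2 r : R, 0 < r & b < cos r ^+ 2 /\ r <= pi / 2.
  have := @continuous_cos R 0; rewrite /continuous_at cos0 => cc.
  have : (fun x : R => cos x ^+ 2) @ (0 : R) --> (1 ^+ 2 : R).
    exact: (kcvgX (n:=2) cc).
  rewrite expr1n => /cvgr_gt /(_ _ b1) /nbhs_ballP[r /= r0 H].
  have pi20 : 0 < pi / 2 :> R by rewrite divr_gt0// pi_gt0.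
  exists (Num.min (r / 2) (pi / 2)); first by rewrite lt_min pi20 divr_gt0.
  split; last by rewrite ge_min lexx orbT.
  apply: H; rewrite /ball/= sub0r normrN gtr0_norm; last first.
    by rewrite lt_min pi20 divr_gt0.
  by rewrite gt_min ltr_pdivrMr// ltr_pMr// ltrDl ltr01.
exists r => // c /andP[c0 c1] cr; apply: (lt_le_trans br).
have cN : -1 <= c <= 1 by rewrite c1 andbT (le_trans _ c0)// lerN10.
have cosr0 : 0 <= cos r by apply: cos_ge0_pihalf; rewrite r2 andbT; have := pi_ge0 R; lra.
have r2pi : r <= pi by have := pi_ge0 R; lra.
rewrite ler_sqr ?nnegrE// -[leRHS]acosK ?in_itv//= ler_cos ?in_itv/= ?(ltW r0) ?r2pi//.
  exact: ltW.
by rewrite acos_ge0// acos_lepi.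
Qed.

(** This is <w, w> cos^2 d = <v, v> for w = (<v, v> / <q, v>) q, where x = <q, v>, y = <v, v> and
n = <q, q>. *)
Lemma norm_scaled (x y n : R[i]) : x != 0 -> 0 < y -> 0 < n ->
  y / x * (y / x)^* * n * (`|x| ^+ 2 / (y * n)) = y.
Proof.
move=> x0 y0 n0; rewrite -normCK normrM normfV (ger0_norm (ltW y0)).
have nx : `|x| != 0 by rewrite normr_eq0.
move: (`|x|) nx (lt0r_neq0 y0) (lt0r_neq0 n0); clear.
by move=> x x0 y0 n0; field; rewrite x0 y0 n0.
Qed.

(** Local lifts exist: the representative w of q with <w, v> = <v, v>, that is the affine chart
centred at v, satisfies |w - v| = |v| tan d, where d is the distance of the two points. *)
Lemma cvg_lift v : v != 0 -> exists w : P2 R -> 'rV[R[i]]_3,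
  [/\ forall q, w q != 0, forall q, proj (w q) = q &
      forall j, (fun q => w q 0 j : C) @ nbhs (proj v) --> (v 0 j : C)].
Proof.
move=> v0; have dv0 : 0 < dotmx v v by rewrite dnorm_gt0.
pose k q : R[i] := if dotmx (coords q) v == 0 then 1
  else dotmx v v / dotmx (coords q) v.
have k0 q : k q != 0.
  rewrite /k; case: (eqVneq (dotmx (coords q) v) 0) => [_|h]; first exact: oner_neq0.
  exact: (mulf_neq0 (lt0r_neq0 dv0) (invr_neq0 h)).
exists (fun q => k q *: coords q); split.
- by move=> q; rewrite scaler_eq0 negb_or k0 coords_neq0.
- by move=> q; rewrite projZ// proj_coords.
move=> j; apply/kcvgP => e /cpos_real[d d0 ->].
have [D D0 DE] := cpos_real dv0.
(* b is the squared cosine of the angle whose tangent is d / |v|. *)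
pose b := D / (D + d ^+ 2).
have Dd : 0 < D + d ^+ 2 by rewrite addr_gt0// exprn_gt0.
have b0 : 0 < b by rewrite divr_gt0.
have b1 : b < 1 by rewrite ltr_pdivrMr// mul1r ltrDl exprn_gt0.
have [r r0 rP] := acos_lt_sqr b1.
apply/nbhs_ballP; exists r => //= q; rewrite ballEmdist/= -[mdist _ _]/(fs_dist _ _) => qr.
have cq := rP _ (fs_cos01 (proj v) q) qr.
have cq0 := coords_neq0 q.
have := fs_cos_sqr v0 cq0; rewrite proj_coords => fE.
have dq0 : 0 < dotmx (coords q) (coords q) by rewrite dnorm_gt0.
have nvq : dotmx (coords q) v != 0.
  apply: contraTneq cq => h; rewrite -leNgt -lecR fE dotmxC h conjC0 normr0 expr0n/= mul0r.
  by rewrite (_ : 0 = 0%:C%C)// lecR ltW.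
have kE : k q = dotmx v v / dotmx (coords q) v by rewrite /k (negbTE nvq).
set w := k q *: coords q.
have wv : dotmx w v = dotmx v v by rewrite /w linearZl_LR/= kE mulfVK.
have ww : dotmx w w * ((fs_cos (proj v) q) ^+ 2)%:C%C = dotmx v v.
  have vq : `|dotmx v (coords q)| = `|dotmx (coords q) v| by rewrite dotmxC norm_conjC.
  rewrite fE vq dotmxZZ kE.
  exact: (norm_scaled nvq dv0 dq0).
have [W W0 WE] : exists2 W : R, 0 < W & dotmx w w = W%:C%C.
  by apply: cpos_real; rewrite dnorm_gt0 scaler_eq0 negb_or k0.
apply: (lt_normc d0); have := sqr_coord_le (w - v) j.
rewrite (dotmxB_proj wv) WE DE !mxE => /le_lt_trans; apply.
move: ww; rewrite WE DE -rmorphM -rmorphB => /complexI WD; rewrite ltcR.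
move: (fs_cos (proj v) q ^+ 2) cq WD; rewrite /b; clear -b0 W0 Dd D0 => c cc Wc.
have c0 : 0 < c := lt_trans b0 cc.
by rewrite ltrBlDl -(ltr_pM2r c0) Wc; move: cc; rewrite ltr_pdivrMr// mulrC.
Qed.

End Metric.

(** * The Joukowski coordinate and the iterates of F *)

Section Dynamics.
Context {R : realType}.
Local Notation C := R[i]^o.
Implicit Types (z : 'rV[R[i]]_3) (p q : P2 R) (s : R[i]).

Lemma row3E (a b c : R[i]) :
  (row3 a b c 0 0 = a) * (row3 a b c 0 1 = b) * (row3 a b c 0 2 = c).
Proof. by rewrite !mxE. Qed.

Lemma ord3P (P : 'I_3 -> Prop) : P 0 -> P 1 -> P 2 -> forall j, P j.
Proof.
move=> P0 P1 P2 [[|[|[|//]]] h].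
- by rewrite (_ : Ordinal h = 0)//; exact/val_inj.
- by rewrite (_ : Ordinal h = 1)//; exact/val_inj.
- by rewrite (_ : Ordinal h = 2)//; exact/val_inj.
Qed.

Lemma row3_eta z : z = row3 (z 0 0) (z 0 1) (z 0 2).
Proof. by apply/rowP; apply: ord3P; rewrite !row3E. Qed.

Lemma row3Z k (a b c : R[i]) : k *: row3 a b c = row3 (k * a) (k * b) (k * c).
Proof. by apply/rowP; apply: ord3P; rewrite mxE !row3E. Qed.

Lemma row3_eq0 (a b c : R[i]) :
  (row3 a b c == 0) = [&& a == 0, b == 0 & c == 0].
Proof.
apply/eqP/and3P => [h|[/eqP-> /eqP-> /eqP->]].
  by split; apply/eqP; [have := congr1 (fun v : 'rV_3 => v 0 0) h|
    have := congr1 (fun v : 'rV_3 => v 0 1) h|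
    have := congr1 (fun v : 'rV_3 => v 0 2) h]; rewrite row3E mxE.
by apply/rowP; apply: ord3P; rewrite row3E mxE.
Qed.

Lemma qformE (a b c : R[i]) : qform (row3 a b c) = a ^+ 2 - b ^+ 2 - c ^+ 2.
Proof. by rewrite /qform !row3E. Qed.

(** With tau = Q / (2 z1 z2), this says 2 tau = s + 1/s; clearing denominators lets s = 0 stand
for tau = oo. *)
Definition joukowski z s : Prop := s * qform z = (1 + s ^+ 2) * (z 0 1 * z 0 2).

Lemma joukowskiZ k z s : joukowski z s -> joukowski (k *: z) s.
Proof.
rewrite /joukowski /qform !mxE => h.
transitivity (k ^+ 2 * (s * qform z)); first by rewrite /qform; ring.
by rewrite /qform h; ring.
Qed.

(** The polynomial lift of F, divided by the factor Q / (1 + s^2) that its coordinates share. *)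
Definition reduced_step z s : 'rV[R[i]]_3 :=
  row3 ((1 + s ^+ 2) * z 0 0) (s * z 0 1) ((1 + s ^+ 2) * z 0 2 + s * z 0 1).

Lemma Fpoly_joukowski z s : joukowski z s ->
  (1 + s ^+ 2) *: Fpoly z = qform z *: reduced_step z s.
Proof.
rewrite /joukowski => h; rewrite /Fpoly /reduced_step !row3Z; congr row3.
- by ring.
- transitivity (z 0 1 * ((1 + s ^+ 2) * (z 0 1 * z 0 2))); first by ring.
  by rewrite -h; ring.
- transitivity ((1 + s ^+ 2) * z 0 2 * qform z + z 0 1 * ((1 + s ^+ 2) * (z 0 1 * z 0 2))).
    by rewrite /qform; ring.
  by rewrite -h; ring.
Qed.

(** The semiconjugacy of F with T(x) = 2 x^2 - 1, as T((s + 1/s) / 2) = (s^2 + s^-2) / 2. *)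
Lemma joukowski_step z s : joukowski z s -> joukowski (reduced_step z s) (s ^+ 2).
Proof.
rewrite /joukowski => h; apply/eqP; rewrite -subr_eq0 /reduced_step qformE !row3E; apply/eqP.
transitivity (s * (1 + s ^+ 2) ^+ 2 * (s * qform z - (1 + s ^+ 2) * (z 0 1 * z 0 2))).
  by rewrite /qform; ring.
by rewrite h subrr mulr0.
Qed.

(** A nonzero value of the polynomial lift forces Q and the reduced step to be nonzero, so
avoiding the indeterminacy set is enough to work with the reduced step alone. *)
Lemma Fmap_joukowski z s : z != 0 -> ~ indet (proj z) -> joukowski z s -> 1 + s ^+ 2 != 0 ->
  reduced_step z s != 0 /\ Fmap (proj z) = proj (reduced_step z s).
Proof.
move=> z0 zI zs s0; rewrite Fmap_proj//.
have F0 : (1 + s ^+ 2) *: Fpoly z != 0.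
  by rewrite scaler_eq0 negb_or s0; apply: contra_notN zI => /eqP/(indet_proj z0).2.
have := F0; rewrite (Fpoly_joukowski zs) scaler_eq0 negb_or => /andP[q0 H0].
by split=> //; rewrite -(projZ _ s0) (Fpoly_joukowski zs) projZ.
Qed.

Lemma indet_in_infty p : indet p -> indet_infty p.
Proof. by move=> pI; exists 1%N => //; exists 1%N; split. Qed.

Lemma indet_infty_preim p : ~ indet p -> indet_infty (Fmap p) -> indet_infty p.
Proof.
move=> pI [n n1 [k [/andP[]]]]; case: k => // k _ kn jk kI.
exists n.+1 => //; exists k.+2; split=> //=.
  move=> [_|j jk1]; first exact: pI.
  by rewrite iterSr; apply: jk; rewrite -ltnS.
by rewrite -iterS iterSr.
Qed.

(** The n-fold reduced step started at z, multiplied by 1 - s^2, where m + 1 = 2 ^ n: the factors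
1 + s^2, 1 + s^4, ... telescope. *)
Definition iter_lift z s m : 'rV[R[i]]_3 :=
  row3 (z 0 0 * (1 - s ^+ (2 * m + 2))) (z 0 1 * (s ^+ m * (1 - s ^+ 2)))
    (z 0 2 * (1 - s ^+ (2 * m + 2)) + z 0 1 * (s - s ^+ (2 * m + 1))).

Lemma iter_lift0 z s : iter_lift z s 0 = (1 - s ^+ 2) *: z.
Proof. by rewrite [in RHS](row3_eta z) row3Z; congr row3; ring. Qed.

Lemma reduced_step_iter_lift z s m :
  reduced_step (iter_lift z s m) (s ^+ m.+1) = iter_lift z s (2 * m + 1).
Proof.
rewrite /reduced_step /iter_lift !row3E.
have -> : (2 * (2 * m + 1) + 2 = m + m + m + m + 4)%N by lia.
have -> : (2 * (2 * m + 1) + 1 = m + m + m + m + 3)%N by lia.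
have -> : (2 * m + 2 = m + m + 2)%N by lia.
have -> : (2 * m + 1 = m + m + 1)%N by lia.
by rewrite !(exprD _ _ _, exprS s m); congr row3; ring.
Qed.

Lemma pow2_pred n : ((2 ^ n.+1).-1 = 2 * (2 ^ n).-1 + 1)%N.
Proof. by rewrite expnS; have := expn_gt0 2 n; case: (2 ^ n)%N => // m _; lia. Qed.

Lemma expr_neq1 s n : `|s| < 1 -> (0 < n)%N -> s ^+ n != 1.
Proof.
move=> s1 n0; apply: contraTneq s1 => h; rewrite -(expr_lt1 n0)// -normrX h normr1.
by rewrite ltxx.
Qed.

Lemma addr_expr_neq0 s n : `|s| < 1 -> (0 < n)%N -> 1 + s ^+ n != 0.
Proof.
move=> s1 n0; rewrite addrC addr_eq0; apply: contraTneq s1 => h.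
by rewrite -(expr_lt1 n0)// -normrX h normrN1 ltxx.
Qed.

(** No iterate is indeterminate, so each one is computed by the reduced step, with s squared every
time. *)
Lemma iter_joukowski z s : z != 0 -> `|s| < 1 -> joukowski z s -> ~ indet_infty (proj z) ->
  forall n, iter_lift z s (2 ^ n).-1 != 0 /\
    iter n (@Fmap R) (proj z) = proj (iter_lift z s (2 ^ n).-1).
Proof.
move=> z0 s1 zs zI.
suff H n : [/\ iter_lift z s (2 ^ n).-1 != 0, joukowski (iter_lift z s (2 ^ n).-1) (s ^+ (2 ^ n)),
    iter n (@Fmap R) (proj z) = proj (iter_lift z s (2 ^ n).-1) &
    ~ indet_infty (iter n (@Fmap R) (proj z))].
  by move=> n; have [] := H n.
have s20 : 1 - s ^+ 2 != 0 by rewrite subr_eq0 eq_sym expr_neq1.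
elim: n => [|n [G0 Gs nE nI]].
  rewrite expn0 iter_lift0 projZ// scaler_eq0 negb_or s20; split=> //.
  by rewrite expr1; exact: joukowskiZ.
have GE : reduced_step (iter_lift z s (2 ^ n).-1) (s ^+ (2 ^ n)) = iter_lift z s (2 ^ n.+1).-1.
  by rewrite pow2_pred -reduced_step_iter_lift prednK// expn_gt0.
have nI' : ~ indet (proj (iter_lift z s (2 ^ n).-1)).
  by rewrite -nE => /indet_in_infty.
have sn0 : 1 + (s ^+ (2 ^ n)) ^+ 2 != 0.
  by rewrite -exprM addr_expr_neq0// muln_gt0 expn_gt0.
have [H0 HE] := Fmap_joukowski G0 nI' Gs sn0.
rewrite -GE; split=> //.
- by rewrite expnSr exprM; exact: joukowski_step.
- by rewrite iterS nE.
- by rewrite iterS => /indet_infty_preim; rewrite nE => /(_ nI'); rewrite -nE.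
Qed.

(** In terms of s = exp(i theta) and M = m + 1 the point is
[sin theta : sin (M theta) : - sin ((M - 1) theta)]. A step of F halves M and doubles theta. *)
Definition indet_curve s m : 'rV[R[i]]_3 :=
  row3 (s ^+ m * (1 - s ^+ 2)) (1 - s ^+ (2 * m + 2)) (s ^+ (2 * m + 1) - s).

(** With a = M theta and b = (M - 1) theta this is
sin (a - b)^2 = sin (a)^2 + sin (b)^2 - 2 sin (a) sin (b) cos (a - b). *)
Lemma joukowski_indet_curve s m : joukowski (indet_curve s m) s.
Proof.
rewrite /joukowski /indet_curve qformE !row3E.
have -> : (2 * m + 2 = m + m + 2)%N by lia.
have -> : (2 * m + 1 = m + m + 1)%N by lia.
by rewrite !exprD; ring.
Qed.

Lemma reduced_step_indet_curve s m :
  reduced_step (indet_curve s (2 * m + 1)) s = s *: indet_curve (s ^+ 2) m.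
Proof.
rewrite /reduced_step /indet_curve !row3E row3Z -!exprM.
have -> : (2 * (2 * m + 1) + 2 = m + m + m + m + 4)%N by lia.
have -> : (2 * (2 * m + 1) + 1 = m + m + m + m + 3)%N by lia.
have -> : (2 * (2 * m + 2) = m + m + m + m + 4)%N by lia.
have -> : (2 * (2 * m + 1) = m + m + m + m + 2)%N by lia.
have -> : (2 * m + 1 = m + m + 1)%N by lia.
have -> : (2 * m = m + m)%N by lia.
by rewrite !exprD; congr row3; ring.
Qed.

(** Each step of F halves the degree of the curve, until the indeterminate point [1 : 1 : 0]. The
condition on s keeps the points, and the values 1 + s^2 along the way, nonzero; an orbit that
becomes indeterminate earlier is in I_oo as well. *)
Lemma indet_curve_infty n s : s != 0 -> s ^+ (2 ^ n.+1) != 1 ->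
  indet_infty (proj (indet_curve s (2 ^ n).-1)).
Proof.
elim: n s => [|n IH] s s0 sn.
  have nz : indet_curve s 0 != 0.
    rewrite row3_eq0 muln0 add0n expr0 mul1r subr_eq0 eq_sym.
    by move: sn; rewrite expn1 => /negbTE->.
  apply: indet_in_infty; apply/(indet_proj nz).
  rewrite /Fpoly /indet_curve qformE !row3E muln0 !add0n expr1 subrr expr0 mul1r.
  by rewrite !(mul0r, mulr0, expr0n)/= subr0 subrr mulr0; apply/eqP; rewrite row3_eq0 eqxx.
have E2 : (2 * (2 ^ n.+1).-1 + 2 = 2 ^ n.+2)%N.
  by rewrite (expnS 2 n.+1); have := expn_gt0 2 n.+1; case: (2 ^ n.+1)%N => // k _; lia.
have nz : indet_curve s (2 ^ n.+1).-1 != 0.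
  by apply: contra sn; rewrite row3_eq0 E2 => /and3P[_ + _]; rewrite subr_eq0 eq_sym.
have [pI|pI] := pselect (indet (proj (indet_curve s (2 ^ n.+1).-1))).
  exact: indet_in_infty.
have s20 : 1 + s ^+ 2 != 0.
  apply: contraNneq sn => /eqP; rewrite addrC addr_eq0 => /eqP h.
  by rewrite !expnS mulnA exprM (exprM s 2 2) h sqrrN !expr1n.
have [H0 HE] := Fmap_joukowski nz pI (joukowski_indet_curve _ _) s20.
apply: indet_infty_preim => //; rewrite HE pow2_pred reduced_step_indet_curve projZ//.
by apply: IH; rewrite ?expf_neq0// -exprM -expnS.
Qed.

End Dynamics.

(** * Complex limits and dense sequences of roots *)

Section ComplexLimits.
Context {R : realType}.
Local Notation C := R[i]^o.

Lemma normC_real (x : R[i]) : exists2 r : R, 0 <= r & `|x| = r%:C%C.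
Proof. by rewrite normc_def; exists (Num.sqrt (complex.Re x ^+ 2 + complex.Im x ^+ 2)). Qed.

Lemma cvg_real_complex (T : Type) (F : set_system T) (FF : Filter F) (r : T -> R) (l : R) :
  r @ F --> l -> (fun t => (r t)%:C%C : C) @ F --> (l%:C%C : C).
Proof.
move=> rl; apply/kcvgP => e /cpos_real[d d0 ->].
move/cvgrPdistC_lt : rl => /(_ _ d0); apply: filterS => t.
by rewrite -rmorphB normc_def/= expr0n/= addr0 sqrtr_sqr ltcR.
Qed.

Lemma cvg_Complex (T : Type) (F : set_system T) (FF : Filter F) (a b : T -> R) (x y : R) :
  a @ F --> x -> b @ F --> y ->
  (fun t => (a t +i* b t)%C : C) @ F --> ((x +i* y)%C : C).
Proof.
move=> ax b_y.
rewrite (complexE (x +i* y)%C); under eq_fun => t do rewrite (complexE (a t +i* b t)%C)/=.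
by apply: kcvgD; [|apply: kcvgM; first exact: kcvg_cst]; exact: cvg_real_complex.
Qed.

(** The exponent and the base vary together, as needed for locally uniform convergence. *)
Lemma kcvg_powy (T : Type) (F : set_system T) (FF : Filter F) (f : T -> C) (a : C)
    (m : T -> nat) : f @ F --> a -> `|a| < 1 -> m @ F --> \oo ->
  (fun t => f t ^+ m t : C) @ F --> (0 : C).
Proof.
move=> fa; have [r r0 rE] := normC_real a.
rewrite rE -[1 : R[i]]/(1%:C%C) ltcR => r1 mF.
pose q := (r + 1) / 2; have rq : r < q by rewrite /q; lra.
have q1 : q < 1 by rewrite /q; lra.
have q0 : 0 <= q by rewrite /q; lra.
apply/kcvgP => e /cpos_real[d d0 ->].
have qe : \forall n \near \oo, q ^+ n < d.
  have /cvgr_lt : (GRing.exp q : R^nat) @ \oo --> 0 by apply: cvg_expr; rewrite ger0_norm.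
  exact.
have dq : 0 < (q - r)%:C%C :> R[i] by rewrite ltcR subr_gt0.
move/kcvgP : fa => /(_ _ dq) fa.
apply: filterS2 fa (mF _ qe) => t ft /= qd; rewrite subr0 normrX; rewrite -ltcR in qd.
apply: le_lt_trans qd; rewrite rmorphXn/=.
apply: lerXn2r; rewrite ?nnegrE; [exact: normr_ge0|by rewrite ler0c|].
have h : `|f t| <= `|f t - a| + `|a| by rewrite -{1}[f t](subrK a); exact: (@ler_normD R[i] R[i]).
apply: (le_trans h); rewrite rE -lerBrDr -rmorphB; exact: ltW.
Qed.

Lemma kcvg_pow0 (a : C) (m : nat -> nat) : `|a| < 1 -> m @ \oo --> \oo ->
  (fun n => a ^+ m n : C) @ \oo --> (0 : C).
Proof. by move=> a1 mo; exact: (@kcvg_powy _ _ _ (fun=> a) a m (kcvg_cst a) a1 mo). Qed.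

Definition cis (x : R) : R[i] := (cos x +i* sin x)%C.

Lemma cisD x y : cis (x + y) = cis x * cis y.
Proof.
rewrite /cis cosD sinD; apply/eqP; rewrite eq_complex/= [sin x * cos y + _]addrC.
by apply/andP; split; apply/eqP; ring.
Qed.

Lemma cis0 : cis 0 = 1.
Proof. by rewrite /cis cos0 sin0. Qed.

Lemma cisMn x n : cis (x *+ n) = cis x ^+ n.
Proof. by elim: n => [|n IH]; rewrite ?mulr0n ?cis0// mulrS cisD IH exprS. Qed.

Lemma cis_2pi_nat n : cis (pi *+ 2 * n%:R) = 1.
Proof. by rewrite mulr_natr cisMn /cis cos2pi sin2pi -[(1 +i* 0)%C]/(1 : R[i]) expr1n. Qed.

Lemma cis_2pi_int (k : int) : cis (pi *+ 2 * k%:~R) = 1.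
Proof.
case: k => n; first exact: cis_2pi_nat.
rewrite NegzE mulrNz mulrN; set x := _ * _.
have : cis (- x + x) = 1 by rewrite addNr cis0.
by rewrite cisD (cis_2pi_nat n.+1) mulr1.
Qed.

Lemma unit_cis (u : R[i]) : `|u| = 1 -> exists b, u = cis b.
Proof.
case: u => x y; rewrite normc_def/= => /(congr1 (@complex.Re R))/= /(congr1 (fun x => x ^+ 2)).
rewrite sqr_sqrtr ?addr_ge0 ?sqr_ge0// expr1n => xy.
have x1 : -1 <= x <= 1.
  by rewrite -ler_norml -(@expr_le1 _ 2)// real_normK ?num_real// -xy lerDl sqr_ge0.
have yE : sin (acos x) = `|y|.
  by rewrite sin_acos// -xy [x ^+ 2 + _]addrC addrK sqrtr_sqr.
have [y0|y0] := leP 0 y.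
  by exists (acos x); rewrite /cis acosK ?in_itv// yE ger0_norm.
by exists (- acos x); rewrite /cis cosN sinN acosK ?in_itv// yE ltr0_norm// opprK.
Qed.

Lemma half_expn_cvg0 (c : R) : (fun n => c / 2 ^+ n : R) @ \oo --> (0 : R).
Proof.
under eq_fun do rewrite -exprVn.
rewrite -(mulr0 c); apply: (@kcvgM R); first exact: kcvg_cst.
by apply: cvg_expr; rewrite ger0_norm ?invr_ge0// invf_lt1// ltr1n.
Qed.

(** The arguments of the (2 ^ n)-th roots of w form a progression of step 2 pi / 2 ^ n, and their
modulus |w|^(1 / 2^n) tends to 1. *)
Lemma roots_dense (w z : R[i]) : w != 0 -> `|z| = 1 ->
  exists s : nat -> R[i], (forall n, s n ^+ (2 ^ n) = w) /\
    (fun n => s n : C) @ \oo --> (z : C).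
Proof.
move=> w0 /unit_cis[t ->].
have [r + rE] := normC_real w; rewrite le0r => /orP[/eqP r0|r0].
  by move/eqP: rE; rewrite r0 normr_eq0 (negbTE w0).
have rC0 : r%:C%C != 0 :> R[i] by rewrite -rE normr_eq0.
have [b bE] : exists b, w / r%:C%C = cis b.
  by apply: unit_cis; rewrite normrM normfV rE ger0_norm ?ler0c ?(ltW r0)// divff.
have wE : w = r%:C%C * cis b by rewrite -bE mulrC divfK.
pose k n := Num.floor ((2 ^+ n * t - b) / (pi *+ 2)).
pose phi n := (b + pi *+ 2 * (k n)%:~R) / 2 ^+ n.
have p0 : 0 < pi *+ 2 :> R by rewrite pmulrn_lgt0// pi_gt0.
have n20 n : 0 < 2 ^+ n :> R by rewrite exprn_gt0.
have phit : phi @ \oo --> t.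
  have lim0 : (fun n => t - (pi *+ 2) / 2 ^+ n : R) @ \oo --> t.
    by rewrite -[X in _ --> X]subr0; apply: (@kcvgB R); [exact: kcvg_cst|exact: half_expn_cvg0].
  apply: (squeeze_cvgr _ lim0 (kcvg_cst (K:=R) t)); apply: nearW => n.
  have := floor_le ((2 ^+ n * t - b) / (pi *+ 2)).
  have := floorD1_gt ((2 ^+ n * t - b) / (pi *+ 2)).
  rewrite -/(k n) ltr_pdivrMr// ler_pdivlMr// intrD mulrDl mul1r => h1 h2.
  rewrite lerBlDr /phi -mulrDl ler_pdivlMr// ler_pdivrMr//.
  by apply/andP; split; lra.
exists (fun n => (expR (ln r / 2 ^+ n))%:C%C * cis (phi n)); split=> [n|].
  rewrite exprMn -rmorphXn -expRM_natl -cisMn wE; congr (_%:C%C * _).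
    by rewrite natrX mulrC divfK ?gt_eqF// lnK.
  rewrite -mulr_natr natrX /phi divfK ?gt_eqF// cisD.
  by rewrite cis_2pi_int mulr1.
rewrite -[X in _ --> X]mul1r; apply: kcvgM.
  apply: (@cvg_real_complex _ _ _ _ 1).
  rewrite -[X in _ --> X]expR0; apply: continuous_cvg; first exact: continuous_expR.
  exact: (half_expn_cvg0 (ln r)).
apply: cvg_Complex; apply: (continuous_cvg _ _ phit).
  exact: continuous_cos.
exact: continuous_sin.
Qed.

End ComplexLimits.

(** * Points of the extended indeterminacy set *)

Section ExtendedIndeterminacy.
Context {R : realType}.
Local Notation C := R[i]^o.
Implicit Types (z : 'rV[R[i]]_3) (s : R[i]).

Lemma cvg_row3 (T : Type) (F : set_system T) (FF : Filter F) (f g h : T -> C) (a b c : C) :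
  f @ F --> a -> g @ F --> b -> h @ F --> c ->
  forall j, (fun t => row3 (f t) (g t) (h t) 0 j : C) @ F --> (row3 a b c 0 j : C).
Proof.
move=> fa gb hc; have eqv j (k : T -> C) (d : C) :
    (forall t, row3 (f t) (g t) (h t) 0 j = k t) -> row3 a b c 0 j = d -> k @ F --> d ->
    (fun t => row3 (f t) (g t) (h t) 0 j : C) @ F --> (row3 a b c 0 j : C).
  by move=> kE -> kd; rewrite (_ : (fun t => _) = k)//; exact/funext.
apply: ord3P.
- by apply: (eqv _ _ _ _ _ fa) => [t|]; rewrite row3E.
- by apply: (eqv _ _ _ _ _ gb) => [t|]; rewrite row3E.
- by apply: (eqv _ _ _ _ _ hc) => [t|]; rewrite row3E.
Qed.

Lemma ext_indet_sub (p : P2 R) : indet_infty p -> ext_indet R p.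
Proof. exact: subset_closure. Qed.

Lemma ext_indet_lim (v : nat -> 'rV[R[i]]_3) z : z != 0 ->
  (forall j, (fun n => v n 0 j : C) @ \oo --> (z 0 j : C)) ->
  (forall n, ext_indet R (proj (v n))) -> ext_indet R (proj z).
Proof.
move=> z0 vz vE; apply: (@closed_cvg _ _ \oo _ (fun n => proj (v n)) (ext_indet R)).
- exact: closed_closure.
- exact: nearW.
- exact: cvg_proj.
Qed.

Lemma pow2_pred_cvgy (a b : nat) : (fun n => (a.+1 * (2 ^ n).-1 + b)%N) @ \oo --> \oo.
Proof.
apply/cvgnyPge => A; near=> n.
have nA : (A <= n)%N by near: n; exact: nbhs_infty_ge.
have : (n < 2 ^ n)%N by exact: ltn_expl.
case: (2 ^ n)%N => // k nk /=; rewrite mulSn.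
by apply: leq_trans nA _; rewrite -addnA (leq_trans _ (leq_addr _ _)).
Unshelve. all: by end_near. Qed.

(** The limit of the indeterminate curves as the degree grows with s fixed. *)
Lemma ext_indet_disc s : `|s| < 1 -> ext_indet R (proj (row3 0 1 (- s))).
Proof.
move=> s1.
have n0 t : row3 0 1 (- t) != 0 :> 'rV[R[i]]_3 by rewrite row3_eq0 oner_eq0 andbF.
have [->|s0] := eqVneq s 0.
  apply/ext_indet_sub/indet_in_infty/(indet_proj (n0 _)).
  rewrite /Fpoly qformE !row3E oppr0 !(mul0r, mulr0).
  by apply/eqP; rewrite row3_eq0 eqxx.
apply: (@ext_indet_lim (fun n => indet_curve s (2 ^ n).-1)) => //; last first.
  move=> n; apply/ext_indet_sub/indet_curve_infty => //.
  by rewrite expr_neq1// expn_gt0.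
have lim a b : (fun n => s ^+ (a.+1 * (2 ^ n).-1 + b) : C) @ \oo --> (0 : C).
  exact: kcvg_pow0 s1 (pow2_pred_cvgy a b).
apply: cvg_row3.
- rewrite -[X in _ --> X](mul0r (1 - s ^+ 2)); apply: kcvgM; last exact: kcvg_cst.
  by have := lim 0 0; under eq_fun do rewrite mul1n addn0.
- rewrite -[X in _ --> X](subr0 1); apply: kcvgB; first exact: kcvg_cst.
  exact: (lim 1%N 2%N).
- rewrite -[X in _ --> X](sub0r s); apply: kcvgB; last exact: kcvg_cst.
  exact: (lim 1%N 1%N).
Qed.

Lemma ext_indet_closed_disc s : `|s| <= 1 -> ext_indet R (proj (row3 0 1 (- s))).
Proof.
move=> s1; pose r (n : nat) : R := 1 - 2^-1 / 2 ^+ n.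
have rl : r @ \oo --> (1 : R).
  rewrite -[X in _ --> X](subr0 1); apply: (@kcvgB R); first exact: kcvg_cst.
  exact: half_expn_cvg0.
have lr : (fun n => (r n)%:C%C : C) @ \oo --> (1 : C) by exact: (cvg_real_complex _ rl).
apply: (@ext_indet_lim (fun n => row3 0 1 (- ((r n)%:C%C * s)))).
- by rewrite row3_eq0 oner_eq0 andbF.
- apply: cvg_row3; try exact: kcvg_cst.
  rewrite -[X in _ --> X]sub0r -[X in _ --> _ - X](mul1r s).
  under eq_fun => n do rewrite -[- _]sub0r.
  apply: kcvgB; first exact: kcvg_cst.
  exact: (kcvgM lr (kcvg_cst s)).
move=> n; apply: ext_indet_disc; rewrite normrM.
have e0 : 0 < 2 ^+ n :> R by rewrite exprn_gt0.
have p0 : 0 < 2^-1 / 2 ^+ n :> R by rewrite divr_gt0// invr_gt0.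
have p1 : 2^-1 / 2 ^+ n <= 1 :> R.
  by rewrite ler_pdivrMr// mul1r (@le_trans _ _ 1)// ?exprn_ege1 ?ler1n// invf_le1// ler1n.
have r0 : 0 <= r n by rewrite subr_ge0.
rewrite ger0_norm ?ler0c//.
have [t t0 tE] := normC_real s; move: s1; rewrite tE -(rmorphM (real_complex R)).
rewrite -[1 : R[i]]/(1%:C%C) ltcR lecR => t1.
by apply: le_lt_trans (ler_piMr r0 t1) _; rewrite ltrBlDr ltrDl.
Qed.

(** In terms of s the quadratic form Q - 2 tau z1 z2 splits into two linear factors in z1 and z2. *)
Lemma joukowski_spec_factor z s : s != 0 -> joukowski z s ->
  (z 0 2 + s * z 0 1) * (z 0 2 + s^-1 * z 0 1) = z 0 0 ^+ 2.
Proof.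
move=> s0 zs; apply: (mulfI s0).
transitivity (s * (z 0 1 ^+ 2 + z 0 2 ^+ 2) + (1 + s ^+ 2) * (z 0 1 * z 0 2)).
  by field.
by rewrite -zs /qform; ring.
Qed.

(** Choose w = (z2 + s z1) / z0 and let t_n tend to s with t_n ^ (2 ^ n) = w: the points of
parameter t_n on the indeterminate curves depend on n only through t_n, and tend to z. *)
Lemma ext_indet_conic z s : `|s| = 1 -> s ^+ 2 != 1 -> joukowski z s ->
  z 0 0 != 0 -> z 0 1 != 0 -> ext_indet R (proj z).
Proof.
move=> s1 s21 zs z0 z1.
have s0 : s != 0 by rewrite -normr_eq0 s1 oner_eq0.
have zf := joukowski_spec_factor s0 zs.
have /andP[a0 b0] : (z 0 2 + s * z 0 1 != 0) && (z 0 2 + s^-1 * z 0 1 != 0).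
  by rewrite -negb_or -mulf_eq0 zf expf_neq0.
pose w := (z 0 2 + s * z 0 1) / z 0 0.
have w0 : w != 0 by rewrite mulf_neq0// invr_eq0.
have wV : z 0 2 + s^-1 * z 0 1 = z 0 0 / w.
  by rewrite /w invf_div mulrA -expr2 -zf mulrAC divff// mul1r.
have wE : z 0 2 + s * z 0 1 = w * z 0 0 by rewrite /w divfK.
have ss0 : s^-1 - s != 0.
  apply: contra s21; rewrite subr_eq0 => /eqP h.
  by rewrite expr2 -{1}h mulVf.
have w2 : 1 - w ^+ 2 = w / z 0 0 * (z 0 1 * (s^-1 - s)).
  have -> : z 0 1 * (s^-1 - s) = z 0 0 / w - w * z 0 0 by rewrite -wV -wE; ring.
  by field; rewrite z0 w0.
have w21 : w ^+ 2 != 1.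
  rewrite eq_sym -subr_eq0 w2.
  exact: (mulf_neq0 (mulf_neq0 w0 (invr_neq0 z0)) (mulf_neq0 z1 ss0)).
have [t [tw ts]] := roots_dense w0 s1.
have t0 n : t n != 0.
  by apply: contraNneq w0 => h; rewrite -(tw n) h expr0n expn_eq0.
pose v n := row3 (z 0 0 * ((t n)^-1 - t n)) (z 0 1 * (s^-1 - s))
  ((z 0 2 + s * z 0 1) * (t n)^-1 - (z 0 2 + s^-1 * z 0 1) * t n).
have vE n : indet_curve (t n) (2 ^ n).-1 = (w / z 0 0) *: v n.
  have tm : t n ^+ (2 ^ n).-1 = w / t n.
    by apply: (mulIf (t0 n)); rewrite -exprSr prednK ?expn_gt0// tw divfK.
  have e2 (x : R[i]) m k : x ^+ (2 * m + k) = (x ^+ m) ^+ 2 * x ^+ k.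
    by rewrite exprD mulnC exprM.
  rewrite /indet_curve /v row3Z !e2 tm expr1 -w2 wE wV.
  congr row3; have := t0 n; move: (t n) => u u0; field; by rewrite ?z0 ?w0 ?u0.
have zE : row3 (z 0 0 * (s^-1 - s)) (z 0 1 * (s^-1 - s)) (z 0 2 * (s^-1 - s)) =
    (s^-1 - s) *: z by rewrite [in RHS](row3_eta z) row3Z; congr row3; ring.
have zn0 : z != 0 by apply: contraNneq z0 => ->; rewrite mxE.
rewrite -(projZ z ss0); apply: (@ext_indet_lim v).
- by rewrite scaler_eq0 negb_or ss0.
- have lV : (fun n => (t n)^-1 : C) @ \oo --> (s^-1 : C) by exact: kcvgV.
  rewrite -zE; apply: cvg_row3.
  + exact: (kcvgM (kcvg_cst (z 0 0)) (kcvgB lV ts)).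
  + exact: kcvg_cst.
  + have -> : z 0 2 * (s^-1 - s) =
      (z 0 2 + s * z 0 1) * s^-1 - (z 0 2 + s^-1 * z 0 1) * s by field.
    exact: (kcvgB (kcvgM (kcvg_cst _) lV) (kcvgM (kcvg_cst _) ts)).
move=> n; have wz0 : w / z 0 0 != 0 by rewrite mulf_neq0// invr_eq0.
rewrite -(projZ _ wz0) -vE; apply/ext_indet_sub/indet_curve_infty => //.
by rewrite expnSr exprM tw.
Qed.

End ExtendedIndeterminacy.

Section Complement.
Context {R : realType}.
Local Notation C := R[i]^o.
Implicit Types (z : 'rV[R[i]]_3) (s : R[i]).

(** Of the two roots the one closer to x will do, since y^2 - x^2 = (y - x) (y + x). *)
Lemma sqrt_near (a x : R[i]) : exists2 y, y ^+ 2 = a & `|y - x| ^+ 2 <= `|a - x ^+ 2|.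
Proof.
have key (y : R[i]) : y ^+ 2 = a -> `|y - x| <= `|y + x| -> `|y - x| ^+ 2 <= `|a - x ^+ 2|.
  by move=> <- h; rewrite subr_sqr normrM expr2 ler_wpM2l.
pose y := sqrtC a; have yE : y ^+ 2 = a by rewrite sqrtCK.
have [h|h] := real_leP (normr_real (y - x)) (normr_real (y + x)).
  by exists y => //; exact: key.
exists (- y); first by rewrite sqrrN.
apply: key; first by rewrite sqrrN.
by rewrite -opprD normrN [- y + x]addrC -(normrN (x - y)) opprB ltW.
Qed.

Lemma cvg_sqrt_near (a : nat -> R[i]) (x : R[i]) :
  (fun n => a n : C) @ \oo --> (x ^+ 2 : C) ->
  exists2 y : nat -> R[i], (forall n, y n ^+ 2 = a n) &
    (fun n => y n : C) @ \oo --> (x : C).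
Proof.
move=> ax; pose y n := projT1 (cid2 (sqrt_near (a n) x)).
have y2 n : y n ^+ 2 = a n by rewrite /y; case: cid2.
have yx n : `|y n - x| ^+ 2 <= `|a n - x ^+ 2| by rewrite /y; case: cid2.
exists y; first exact: y2.
apply/kcvgP => e e0.
have e20 : 0 < e ^+ 2 by rewrite exprn_gt0.
move/kcvgP : ax => /(_ _ e20); apply: filterS => n an.
have : `|y n - x| ^+ 2 < e ^+ 2 by exact: le_lt_trans (yx n) an.
by rewrite ltr_pXn2r// ?nnegrE ?ltW.
Qed.

Lemma ext_indet_spec z s : z != 0 -> `|s| = 1 -> joukowski z s -> ext_indet R (proj z).
Proof.
move=> zn0 s1 zs.
have s0 : s != 0 by rewrite -normr_eq0 s1 oner_eq0.
have [z1|z1] := eqVneq (z 0 1) 0.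
  (* The relation forces Q = 0, so z is one of the indeterminacy points [1 : 0 : +-1]. *)
  have q0 : qform z = 0.
    by move/eqP: zs; rewrite z1 mul0r mulr0 mulf_eq0 (negbTE s0) => /eqP.
  apply/ext_indet_sub/indet_in_infty/(indet_proj zn0).
  have z02 : z 0 0 ^+ 2 - z 0 2 ^+ 2 = 0 by move: q0; rewrite /qform z1 expr0n/= subr0.
  by apply/eqP; rewrite /Fpoly row3_eq0 q0 z1 z02 expr0n/= mul0r !mulr0 eqxx.
have [z0|z0] := eqVneq (z 0 0) 0.
  have : (z 0 2 + s * z 0 1) * (z 0 2 + s^-1 * z 0 1) = 0.
    by rewrite (joukowski_spec_factor s0 zs) z0 expr0n.
  have key t : `|t| = 1 -> z 0 2 + t * z 0 1 = 0 -> ext_indet R (proj z).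
    move=> t1 h; have -> : z = z 0 1 *: row3 0 1 (- t).
      rewrite [LHS](row3_eta z) row3Z z0 mulr0 mulr1; congr row3.
      by rewrite mulrN mulrC; apply/eqP; rewrite -addr_eq0 h.
    by rewrite projZ//; apply: ext_indet_closed_disc; rewrite t1.
  move/eqP; rewrite mulf_eq0 => /orP[] /eqP; apply: key => //.
  by rewrite normfV s1 invr1.
have [s21|s21] := eqVneq (s ^+ 2) 1; last exact: ext_indet_conic s21 zs z0 z1.
(* For s = +-1 the conic is a pair of lines; it is a limit of the conics of t_n -> s,
   where t_n ^ (2 ^ n) = i keeps t_n on the circle and away from +-1. *)
have [t [ti ts]] := @roots_dense R 'i s (neq0Ci _) s1.
have t1 n : `|t n| = 1.
  apply/eqP; rewrite -(@pexpr_eq1 _ _ (2 ^ n))// ?expn_gt0// -normrX ti.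
  by rewrite normCi.
have t0 n : t n != 0 by rewrite -normr_eq0 t1 oner_eq0.
have t2 n : t n ^+ 2 != 1.
  apply/eqP => h; have : (t n ^+ (2 ^ n)) ^+ 2 = 1 by rewrite -exprM mulnC exprM h expr1n.
  rewrite ti sqrCi => /eqP; rewrite eq_sym -subr_eq0 opprK -[1 + 1]/(2%:R : R[i]).
  by rewrite pnatr_eq0.
have lV : (fun n => (t n)^-1 : C) @ \oo --> (s^-1 : C) by exact: kcvgV.
have la : (fun n => (z 0 2 + t n * z 0 1) * (z 0 2 + (t n)^-1 * z 0 1) : C) @ \oo -->
    (z 0 0 ^+ 2 : C).
  rewrite -(joukowski_spec_factor s0 zs).
  exact: (kcvgM (kcvgD (kcvg_cst (z 0 2 : C)) (kcvgM ts (kcvg_cst (z 0 1 : C))))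
    (kcvgD (kcvg_cst (z 0 2 : C)) (kcvgM lV (kcvg_cst (z 0 1 : C))))).
have [y yE yl] := cvg_sqrt_near la.
pose v n := if y n == 0 then row3 0 1 (- t n) else row3 (y n) (z 0 1) (z 0 2).
have yn0 : \forall n \near \oo, y n != 0.
  have nz : 0 < `|z 0 0| by rewrite normr_gt0.
  move/kcvgP : yl => /(_ _ nz); apply: filterS => n; apply: contraTneq => ->.
  by rewrite sub0r normrN ltxx.
apply: (@ext_indet_lim _ v _ zn0).
  move=> j; have l3 : (fun n => row3 (y n) (z 0 1) (z 0 2) 0 j : C) @ \oo --> (z 0 j : C).
    rewrite [in X in _ --> X](row3_eta z).
    exact: (cvg_row3 _ yl (kcvg_cst (z 0 1 : C)) (kcvg_cst (z 0 2 : C))).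
  apply: kcvg_near l3.
  by move: yn0; apply: filterS => n; rewrite /v => /negbTE->.
move=> n; rewrite /v; case: (eqVneq (y n) 0) => [_|y0].
  by apply: ext_indet_closed_disc; rewrite t1.
apply: (@ext_indet_conic R _ (t n)); rewrite ?row3E; try by [].
have := yE n; rewrite /joukowski qformE !row3E => yy; rewrite yy.
by have := t0 n; move: (t n) => u u0; field.
Qed.

(** The product of the two roots s of the defining equation is 1. *)
Lemma joukowski_dichotomy z :
  (exists2 s, `|s| < 1 & joukowski z s) \/ (exists2 s, `|s| = 1 & joukowski z s).
Proof.
rewrite /joukowski; set b := z 0 1 * z 0 2; set q := qform z.
have [b0|b0] := eqVneq b 0.
  by left; exists 0; rewrite ?normr0// b0 mul0r mulr0.
have [s sE] : exists s, s * q = (1 + s ^+ 2) * b.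
  pose d := sqrtC (q ^+ 2 - 4 * b ^+ 2).
  exists ((q + d) / (2 * b)); have : d ^+ 2 = q ^+ 2 - 4 * b ^+ 2 by rewrite sqrtCK.
  move: d => d d2; transitivity ((4 * b ^+ 2 + q ^+ 2 + 2 * q * d + d ^+ 2) / (4 * b)).
    by rewrite d2; field.
  by field.
have s0 : s != 0.
  by apply: contraNneq b0 => s0; move: sE; rewrite s0 mul0r expr0n/= addr0 mul1r => <-.
have [h|h|h] := real_ltgtP (normr_real s) (real1 R[i]).
- by left; exists s.
- left; exists s^-1; first by rewrite normfV invf_lt1// (lt_trans ltr01).
  by apply: (mulfI (expf_neq0 2 s0)); transitivity (s * q); [|rewrite sE]; field.
- by right; exists s.
Qed.

(** The case |s| = 1 lies in E, and so do the points [0 : 1 : -s] with |s| <= 1. The last clause is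
what makes F_* defined. *)
Lemma not_ext_indet z : z != 0 -> ~ ext_indet R (proj z) ->
  exists s, [/\ `|s| < 1, joukowski z s & z 0 0 = 0 -> `|z 0 1| < `|z 0 2|].
Proof.
move=> zn0 zE; have [[s s1 zs]|[s s1 zs]] := joukowski_dichotomy z; last first.
  by case: zE; exact: ext_indet_spec zs.
exists s; split=> // z0; rewrite real_ltNge ?normr_real//; apply/negP => h; apply: zE.
have z1 : z 0 1 != 0.
  apply: contraNneq zn0 => z1; move: h; rewrite z1 normr0 normr_le0 => /eqP z2.
  by rewrite (row3_eta z) row3_eq0 z0 z1 z2 eqxx.
have -> : z = z 0 1 *: row3 0 1 (- - (z 0 2 / z 0 1)).
  by rewrite opprK [LHS](row3_eta z) row3Z z0 mulr0 mulr1 mulrCA divff// mulr1.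
rewrite projZ//; apply: ext_indet_closed_disc.
by rewrite normrN normrM normfV ler_pdivrMr ?normr_gt0// mul1r.
Qed.

End Complement.

(** * The limit function f *)

Section LimitFunction.
Context {R : realType}.
Local Notation C := R[i]^o.
Implicit Types (z : 'rV[R[i]]_3) (s : R[i]).

Lemma joukowski_qform0 z s : joukowski z s -> 1 + s ^+ 2 != 0 -> z 0 1 * z 0 2 = 0 ->
  qform z != 0 -> s = 0.
Proof.
rewrite /joukowski => zs _ b0 q0; move/eqP: zs.
by rewrite b0 mulr0 mulf_eq0 (negbTE q0) orbF => /eqP.
Qed.

Lemma iter_chebT s k : s != 0 ->
  iter k (@chebT R) (Some ((s + s^-1) / 2)) =
  Some ((s ^+ (2 ^ k) + (s ^+ (2 ^ k))^-1) / 2).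
Proof.
move=> s0; elim: k => [|k IH]; first by rewrite expn0 !expr1.
rewrite iterS IH /= expnS mulnC exprM; congr Some.
have : s ^+ (2 ^ k) != 0 by rewrite expf_neq0.
by move: (s ^+ (2 ^ k)) => x x0; field.
Qed.

(** (1 - x^2) (1 + x^2) = 1 - x^4 telescopes over x = s, s^2, s^4, ... *)
Lemma prod_joukowski s j : s != 0 ->
  2 ^+ j * (\prod_(0 <= k < j) ((s ^+ (2 ^ k) + (s ^+ (2 ^ k))^-1) / 2)) *
    (s ^+ (2 ^ j).-1 * (1 - s ^+ 2)) = 1 - s ^+ (2 * (2 ^ j).-1 + 2).
Proof.
move=> s0; elim: j => [|j IH].
  by rewrite expr0 big_geq// expn0 /= !mul1r.
have e2 (x : R[i]) m k : x ^+ (2 * m + k) = (x ^+ m) ^+ 2 * x ^+ k.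
  by rewrite exprD mulnC exprM.
have ej : s ^+ (2 ^ j) = s ^+ (2 ^ j).-1 * s by rewrite -exprSr prednK// expn_gt0.
have x0 : s ^+ (2 ^ j).-1 != 0 by rewrite expf_neq0.
rewrite big_nat_recr//= pow2_pred exprS !e2 ej; move: IH; rewrite e2.
move: (\prod_(0 <= k < j) _) (s ^+ (2 ^ j).-1) x0 (2 ^+ j) => P x x0 D IH.
transitivity (D * P * (x * (1 - s ^+ 2)) * (1 + x ^+ 2 * s ^+ 2)); last first.
  by rewrite IH; ring.
by field; rewrite s0 x0.
Qed.

Lemma fseq_term z s j : z != 0 -> `|s| < 1 -> joukowski z s -> qform z != 0 -> (0 < j)%N ->
  hinv (hmul (Some (2 ^+ j)) (\big[hmul/Some 1]_(0 <= k < j) iter k (@chebT R) (tau (proj z))))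
  = s ^+ (2 ^ j).-1 * (1 - s ^+ 2) / (1 - s ^+ (2 * (2 ^ j).-1 + 2)).
Proof.
move=> z0 s1 zs q0 j0; rewrite tau_proj// (negbTE q0).
have s20 : 1 + s ^+ 2 != 0 by rewrite addr_expr_neq0.
have [b0|b0] := eqVneq (z 0 1 * z 0 2) 0.
  rewrite (joukowski_qform0 zs s20 b0 q0) big_ltn//= !expr0n/=.
  have -> : ((2 ^ j).-1 == 0)%N = false.
    by case: j j0 => // j _; rewrite pow2_pred addn1.
  by rewrite !mul0r.
have s0 : s != 0.
  by apply: contraNneq b0 => s0; move: zs; rewrite /joukowski s0 mul0r expr0n/= addr0 mul1r => <-.
have -> : qform z / (2 * z 0 1 * z 0 2) = (s + s^-1) / 2.
  have -> : qform z = (1 + s ^+ 2) * (z 0 1 * z 0 2) / s by rewrite -zs mulrC mulKf.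
  by move: b0; rewrite mulf_eq0 negb_or => /andP[z1 z2]; field; rewrite s0 z1 z2.
have -> : \big[hmul/Some 1]_(0 <= k < j) iter k (@chebT R) (Some ((s + s^-1) / 2)) =
    Some (\prod_(0 <= k < j) ((s ^+ (2 ^ k) + (s ^+ (2 ^ k))^-1) / 2)).
  by apply: (big_rec2 (fun x y => x = Some y)) => // k x y _ ->; rewrite iter_chebT.
rewrite /= -(prod_joukowski j s0).
have n0 : s ^+ (2 ^ j).-1 * (1 - s ^+ 2) != 0.
  by rewrite mulf_neq0 ?expf_neq0// subr_eq0 eq_sym expr_neq1.
move: n0; move: (s ^+ (2 ^ j).-1 * (1 - s ^+ 2)) => n n0.
by rewrite [in RHS]invfM mulrCA divff// mulr1.
Qed.

(** By induction, the increment being given by the telescoping product. *)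
Lemma fseq_closed z s n : z != 0 -> `|s| < 1 -> joukowski z s -> qform z != 0 ->
  fseq (proj z) n.+1 = (s - s ^+ (2 * (2 ^ n).-1 + 1)) / (1 - s ^+ (2 * (2 ^ n).-1 + 2)).
Proof.
move=> z0 s1 zs q0; rewrite /fseq; elim: n => [|n IH].
  by rewrite big_geq// expn0 /= expr1 subrr mul0r.
rewrite big_nat_recr//= IH (fseq_term z0 s1 zs q0)//.
have e2 (x : R[i]) m k : x ^+ (2 * m + k) = (x ^+ m) ^+ 2 * x ^+ k.
  by rewrite exprD mulnC exprM.
have d1 : 1 - s ^+ (2 * (2 ^ n).-1 + 2) != 0 by rewrite subr_eq0 eq_sym expr_neq1// addn2.
have d2 : 1 - s ^+ (2 * (2 ^ n.+1).-1 + 2) != 0 by rewrite subr_eq0 eq_sym expr_neq1// addn2.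
move: d1 d2; rewrite pow2_pred !e2; move: (s ^+ (2 ^ n).-1) => x d1 d2.
have E1 : (x ^+ 2 * s ^+ 1) ^+ 2 * s ^+ 2 = x ^+ 4 * s ^+ 2 * s ^+ 2 by ring.
by field; rewrite exprMn d1 -E1 d2.
Qed.

Lemma fseq_cvg z s : z != 0 -> `|s| < 1 -> joukowski z s -> qform z != 0 ->
  (fseq (proj z) : nat -> C) @ \oo --> (s : C).
Proof.
move=> z0 s1 zs q0; rewrite -cvg_shiftS.
under eq_fun do rewrite (fseq_closed _ z0 s1 zs q0).
have lim b : (fun n => s ^+ (2 * (2 ^ n).-1 + b) : C) @ \oo --> (0 : C).
  exact: kcvg_pow0 s1 (pow2_pred_cvgy 1 b).
have l1 : (fun n => 1 - s ^+ (2 * (2 ^ n).-1 + 2) : C) @ \oo --> (1 : C).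
  by rewrite -[X in _ --> X](subr0 1); exact: (kcvgB (kcvg_cst (1 : C)) (lim 2%N)).
have l2 : (fun n => s - s ^+ (2 * (2 ^ n).-1 + 1) : C) @ \oo --> (s : C).
  by rewrite -[X in _ --> X](subr0 s); exact: (kcvgB (kcvg_cst (s : C)) (lim 1%N)).
have n1 : (1 : R[i]) != 0 by exact: oner_neq0.
suff : (fun n => (s - s ^+ (2 * (2 ^ n).-1 + 1)) / (1 - s ^+ (2 * (2 ^ n).-1 + 2)) : C) @ \oo
    --> (s : C) by exact.
have sE : s / 1 = s by rewrite invr1 mulr1.
rewrite -[X in _ --> X]sE; exact: (kcvgM l2 (kcvgV n1 l1)).
Qed.

Lemma flim_joukowski z s : z != 0 -> `|s| < 1 -> joukowski z s -> qform z != 0 ->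
  flim (proj z) = s.
Proof.
move=> z0 s1 zs q0; rewrite /flim; apply: (@cvg_lim C (@norm_hausdorff R[i] C)).
exact: fseq_cvg.
Qed.

Lemma joukowski_indet_qform z s : z != 0 -> `|s| < 1 -> joukowski z s -> ~ indet (proj z) ->
  qform z != 0.
Proof.
move=> z0 s1 zs zI; apply: contra_notN zI => /eqP q0; apply/(indet_proj z0).
have := Fpoly_joukowski zs; rewrite q0 scale0r => /eqP.
by rewrite scaler_eq0 (negbTE (addr_expr_neq0 _ _))// => /eqP.
Qed.

Lemma Fstar_joukowski z s : z != 0 -> `|s| < 1 -> joukowski z s -> qform z != 0 ->
  exists2 c, c != 0 &
    Fstar_coords (proj z) = c *: row3 (z 0 0) 0 (z 0 2 + z 0 1 * s).
Proof.
move=> z0 s1 zs q0; have [c c0 cE] := coords_proj z0; exists c => //.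
by rewrite /Fstar_coords (flim_joukowski z0 s1 zs q0) cE !mxE row3Z mulr0; congr row3; ring.
Qed.

(** If both coordinates vanish then z0 = 0 and |z2| = |s| |z1| <= |z1|. *)
Lemma Fstar_vec_neq0 z s : z != 0 -> `|s| < 1 ->
  (z 0 0 = 0 -> `|z 0 1| < `|z 0 2|) -> row3 (z 0 0) 0 (z 0 2 + z 0 1 * s) != 0.
Proof.
move=> zn0 s1 h; rewrite row3_eq0 eqxx /=; apply/negP => /andP[/eqP z0 /eqP z2].
have := h z0; have -> : z 0 2 = - (z 0 1 * s) by apply/eqP; rewrite -addr_eq0 z2.
rewrite normrN normrM; apply/negP; rewrite -real_leNgt ?realM ?normr_real//.
by rewrite ler_piMr// ltW.
Qed.

End LimitFunction.

(** * Convergence of the iterates off E *)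

Section Convergence.
Context {R : realType}.
Local Notation C := R[i]^o.
Implicit Types (z : 'rV[R[i]]_3) (s : R[i]) (p q : P2 R).

Lemma near_not_ext_indet p : ~ ext_indet R p -> \forall q \near p, ~ ext_indet R q.
Proof.
have := closed_openC (@closed_closure _ (@indet_infty R)).
by move=> oE pE; apply: (open_nbhs_nbhs (conj oE pE)).
Qed.

(** A quantitative injectivity of s |-> s / (1 + s^2) on the unit disc:
(s - t) (1 - s t) = (1 + s^2) (1 + t^2) (a - b). *)
Lemma joukowski_inj_bound (a b s t : R[i]) : `|s| < 1 -> `|t| < 1 ->
  s = (1 + s ^+ 2) * a -> t = (1 + t ^+ 2) * b ->
  `|s - t| * (1 - `|t|) <= 4 * `|a - b|.
Proof.
move=> s1 t1 sa tb.
have E : (s - t) * (1 - s * t) = (1 + s ^+ 2) * (1 + t ^+ 2) * (a - b).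
  transitivity (s * (1 + t ^+ 2) - t * (1 + s ^+ 2)); first by ring.
  by rewrite {1}sa {2}tb; ring.
have st : 1 - `|t| <= `|1 - s * t|.
  apply: (@le_trans _ _ (1 - `|s * t|)); last by rewrite -{1}[1]normr1 lerB_dist.
  by rewrite lerD2l lerN2 normrM ler_piMl// ltW.
apply: (@le_trans _ _ (`|s - t| * `|1 - s * t|)); first by rewrite ler_wpM2l.
have le2 u : `|u| < 1 -> `|1 + u ^+ 2| <= 2.
  move=> u1; apply: le_trans (ler_normD _ _) _.
  by rewrite normr1 normrX [leRHS]mulr2n lerD2l exprn_ile1// ltW.
rewrite -normrM E !normrM ler_wpM2r// (_ : 4 = 2 * 2); last by ring.
by rewrite ler_pM// le2.
Qed.

(** A neighbourhood of a point off E carries lifts w and parameters sg, both continuous at the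
point; every limit below is computed from them. *)
Lemma local_joukowski z : z != 0 -> ~ ext_indet R (proj z) ->
  exists (w : P2 R -> 'rV[R[i]]_3) (sg : P2 R -> R[i]) (s : R[i]),
  [/\ forall q, w q != 0 /\ proj (w q) = q,
      forall q, ~ ext_indet R q -> `|sg q| < 1 /\ joukowski (w q) (sg q),
      forall j, (fun q => w q 0 j : C) @ nbhs (proj z) --> (z 0 j : C),
      (fun q => sg q : C) @ nbhs (proj z) --> (s : C) &
      [/\ `|s| < 1, joukowski z s & z 0 0 = 0 -> `|z 0 1| < `|z 0 2|]].
Proof.
move=> z0 zE; have [w [w0 wq wz]] := cvg_lift z0.
have [s [s1 zs zn]] := not_ext_indet z0 zE.
have key q : exists t, ~ ext_indet R q -> `|t| < 1 /\ joukowski (w q) t.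
  have [qE|qE] := pselect (ext_indet R q); first by exists 0.
  have := @not_ext_indet _ (w q) (w0 q); rewrite wq => /(_ qE)[t [t1 wt _]].
  by exists t.
pose sg q := projT1 (cid (key q)).
have sgE q : ~ ext_indet R q -> `|sg q| < 1 /\ joukowski (w q) (sg q).
  by rewrite /sg; case: cid.
exists w, sg, s; split => //.
have qz : qform z != 0.
  by apply: (joukowski_indet_qform z0 s1 zs) => /indet_in_infty/ext_indet_sub.
have lq : (fun q => qform (w q) : C) @ nbhs (proj z) --> (qform z : C).
  exact: (kcvgB (kcvgB (kcvgX (n:=2) (wz 0)) (kcvgX (n:=2) (wz 1))) (kcvgX (n:=2) (wz 2))).
have lb : (fun q => w q 0 1 * w q 0 2 / qform (w q) : C) @ nbhs (proj z) -->
    (z 0 1 * z 0 2 / qform z : C).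
  exact: (kcvgM (kcvgM (wz 1) (wz 2)) (kcvgV qz lq)).
apply/kcvgP => e e0.
have s10 : 0 < 1 - `|s| by rewrite subr_gt0.
have e40 : 0 < e * (1 - `|s|) / 4 by rewrite !mulr_gt0 ?invr_gt0// ltr0n.
have aqz : 0 < `|qform z| by rewrite normr_gt0.
have qn : \forall q \near proj z, qform (w q) != 0.
  move/kcvgP : lq => /(_ _ aqz); apply: filterS => q; apply: contraTneq => ->.
  by rewrite sub0r normrN ltxx.
have En : \forall q \near proj z, ~ ext_indet R q by exact: near_not_ext_indet.
move/kcvgP : lb => /(_ _ e40) lb.
near=> q.
have qE : ~ ext_indet R q by near: q.
have [sq1 sqj] := sgE q qE.
have q0 : qform (w q) != 0 by near: q.
have lbq : `|w q 0 1 * w q 0 2 / qform (w q) - z 0 1 * z 0 2 / qform z| <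
  e * (1 - `|s|) / 4 by near: q.
have E1 : sg q = (1 + sg q ^+ 2) * (w q 0 1 * w q 0 2 / qform (w q)).
  by rewrite mulrA -sqj mulfK.
have E2 : s = (1 + s ^+ 2) * (z 0 1 * z 0 2 / qform z) by rewrite mulrA -zs mulfK.
have := joukowski_inj_bound sq1 s1 E1 E2.
rewrite -(ltr_pM2r s10); move/le_lt_trans; apply.
by rewrite mulrC -ltr_pdivlMr// ltr0n.
Unshelve. all: by end_near. Qed.

End Convergence.

Section FatouSet.
Context {R : realType}.
Local Notation C := R[i]^o.
Implicit Types (z : 'rV[R[i]]_3) (s : R[i]) (p q : P2 R).

Lemma cvg_near_P2 (T : Type) (F : set_system T) (FF : Filter F) (f g : T -> P2 R) p :
  (\forall t \near F, f t = g t) -> f @ F --> p -> g @ F --> p.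
Proof. by move=> fg; apply: cvg_trans; exact: near_eq_cvg. Qed.

Lemma FstarE z s : z != 0 -> `|s| < 1 -> joukowski z s -> ~ ext_indet R (proj z) ->
  Fstar (proj z) = proj (row3 (z 0 0) 0 (z 0 2 + z 0 1 * s)).
Proof.
move=> z0 s1 zs zE.
have q0 : qform z != 0.
  by apply: (joukowski_indet_qform z0 s1 zs) => /indet_in_infty/ext_indet_sub.
by rewrite /Fstar; have [c c0 ->] := Fstar_joukowski z0 s1 zs q0; rewrite projZ.
Qed.

Lemma Fstar_coords_neq0 p : ~ ext_indet R p -> Fstar_coords p != 0.
Proof.
rewrite -(proj_coords p) => pE; have z0 := coords_neq0 p.
have [s [s1 zs zn]] := not_ext_indet z0 pE.
have q0 : qform (coords p) != 0.
  by apply: (joukowski_indet_qform z0 s1 zs) => /indet_in_infty/ext_indet_sub.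
have [c c0 ->] := Fstar_joukowski z0 s1 zs q0.
by rewrite scaler_eq0 negb_or c0; exact: Fstar_vec_neq0.
Qed.

(** Convergence along the product filter is locally uniform convergence of the iterates. *)
Lemma iter_local p : ~ ext_indet R p ->
  [/\ (fun x : nat * P2 R => iter x.1 (@Fmap R) x.2) @ filter_prod \oo (nbhs p) --> Fstar p,
      forall n, iter n (@Fmap R) @ nbhs p --> iter n (@Fmap R) p &
      @Fstar R @ nbhs p --> Fstar p].
Proof.
have [z z0 ->] := proj_surj p => {p} zE.
have [w [sg [s [wq sgE wz lsg [s1 zs zn]]]]] := local_joukowski z0 zE.
have nE := near_not_ext_indet zE.
have iterE n q : ~ ext_indet R q ->
    iter n (@Fmap R) q = proj (iter_lift (w q) (sg q) (2 ^ n).-1).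
  move=> qE; have [q1 qj] := sgE q qE; have [w0 wqE] := wq q.
  have qI : ~ indet_infty (proj (w q)) by rewrite wqE => /ext_indet_sub.
  by have [_] := iter_joukowski w0 q1 qj qI n; rewrite wqE.
have FsE q : ~ ext_indet R q ->
    Fstar q = proj (row3 (w q 0 0) 0 (w q 0 2 + w q 0 1 * sg q)).
  move=> qE; have [q1 qj] := sgE q qE; have [w0 wqE] := wq q.
  by rewrite -{1}wqE; apply: FstarE; rewrite ?wqE.
have zs0 := Fstar_vec_neq0 z0 s1 zn.
rewrite (FstarE z0 s1 zs zE); split.
- pose G := filter_prod \oo (nbhs (proj z)).
  have lift2 (f : P2 R -> C) (a : C) : f @ nbhs (proj z) --> a ->
      (fun x : nat * P2 R => f x.2) @ G --> a.
    by move=> fa; apply: cvg_comp fa; exact: cvg_snd.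
  have pw (a b : nat) : (fun x : nat * P2 R => sg x.2 ^+ (a.+1 * (2 ^ x.1).-1 + b) : C) @ G
      --> (0 : C).
    apply: (kcvg_powy _ (lift2 _ _ lsg) s1).
    by apply: cvg_comp (pow2_pred_cvgy a b); exact: cvg_fst.
  have lw j := lift2 _ _ (wz j); have ls := lift2 _ _ lsg.
  have l1 : (fun x : nat * P2 R => 1 - sg x.2 ^+ (2 * (2 ^ x.1).-1 + 2) : C) @ G --> (1 - 0 : C).
    exact: (kcvgB (kcvg_cst (1 : C)) (pw 1%N 2%N)).
  have l2 : (fun x : nat * P2 R => sg x.2 - sg x.2 ^+ (2 * (2 ^ x.1).-1 + 1) : C) @ G
      --> (s - 0 : C).
    exact: (kcvgB ls (pw 1%N 1%N)).
  have l3 : (fun x : nat * P2 R => sg x.2 ^+ (2 ^ x.1).-1 * (1 - sg x.2 ^+ 2) : C) @ G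
      --> (0 * (1 - s ^+ 2) : C).
    apply: kcvgM (kcvgB (kcvg_cst (1 : C)) (kcvgX (n:=2) ls)).
    by apply: kcvg_near (pw 0%N 0%N); apply: nearW => x; rewrite mul1n addn0.
  have L : forall j,
      (fun x : nat * P2 R => iter_lift (w x.2) (sg x.2) (2 ^ x.1).-1 0 j : C) @ G -->
      (row3 (z 0 0) 0 (z 0 2 + z 0 1 * s) 0 j : C).
    have -> : row3 (z 0 0) 0 (z 0 2 + z 0 1 * s) = row3 (z 0 0 * (1 - 0))
      (z 0 1 * (0 * (1 - s ^+ 2))) (z 0 2 * (1 - 0) + z 0 1 * (s - 0)).
      by rewrite !subr0 mul0r mulr0 !mulr1.
    exact: (cvg_row3 _ (kcvgM (lw 0) l1) (kcvgM (lw 1) l3)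
      (kcvgD (kcvgM (lw 2) l1) (kcvgM (lw 1) l2))).
  apply: cvg_near_P2 (cvg_proj _ zs0 L).
  by near=> x; rewrite iterE//; near: x; exact: (@cvg_snd _ _ \oo (nbhs (proj z)) _ _ nE).
- move=> n; have [_ zE'] := wq (proj z).
  have zI : ~ indet_infty (proj z) by move/ext_indet_sub.
  have [G0 ->] := iter_joukowski z0 s1 zs zI n.
  have L : forall j, (fun q => iter_lift (w q) (sg q) (2 ^ n).-1 0 j : C) @ nbhs (proj z) -->
      (iter_lift z s (2 ^ n).-1 0 j : C).
    have l1 a : (fun q => 1 - sg q ^+ a : C) @ nbhs (proj z) --> (1 - s ^+ a : C).
      exact: (kcvgB (kcvg_cst (1 : C)) (kcvgX lsg)).
    have l2 a : (fun q => sg q - sg q ^+ a : C) @ nbhs (proj z) --> (s - s ^+ a : C).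
      exact: (kcvgB lsg (kcvgX lsg)).
    exact: (cvg_row3 _ (kcvgM (wz 0) (l1 _)) (kcvgM (wz 1) (kcvgM (kcvgX lsg) (l1 2%N)))
      (kcvgD (kcvgM (wz 2) (l1 _)) (kcvgM (wz 1) (l2 _)))).
  apply: cvg_near_P2 (cvg_proj _ G0 L).
  by apply: filterS nE => q qE; rewrite iterE.
- have L : forall j, (fun q => row3 (w q 0 0) 0 (w q 0 2 + w q 0 1 * sg q) 0 j : C)
      @ nbhs (proj z) --> (row3 (z 0 0) 0 (z 0 2 + z 0 1 * s) 0 j : C).
    exact: (cvg_row3 _ (wz 0) (kcvg_cst (0 : C)) (kcvgD (wz 2) (kcvgM (wz 1) lsg))).
  apply: cvg_near_P2 (cvg_proj _ zs0 L).
  by apply: filterS nE => q qE; rewrite FsE.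
Unshelve. all: by end_near. Qed.

End FatouSet.

Section FatouSetE.
Context {R : realType}.
Implicit Types (p q : P2 R).

Lemma diam_le (A : set (P2 R)) p (e : R) :
  (forall q, A q -> mdist p q <= e) -> (diam A <= (e + e)%:E)%E.
Proof.
move=> Ae; apply: ge_ereal_sup => _ [[a b] [/= Aa Ab] <-]; rewrite lee_fin.
have h1 := Ae _ Aa; have h2 := Ae _ Ab; rewrite metric_sym in h1.
exact: (le_trans (metric_triangle a p b) (lerD h1 h2)).
Qed.

Lemma cvg_mdist (T : Type) (F : set_system T) (FF : Filter F) (f : T -> P2 R) p (e : R) :
  0 < e -> f @ F --> p -> \forall t \near F, mdist p (f t) < e.
Proof.
by move=> e0 /cvg_ballP/(_ _ e0); apply: filterS => t; rewrite ballEmdist.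
Qed.

(** Off E, all but finitely many iterates are uniformly close to F_*(p) near p, and the others are
continuous at p. *)
Lemma FatouE : Fatou R = ~` ext_indet R.
Proof.
apply/seteqP; split => [p []//|p pE]; split => // e e0.
have [it in_ _] := iter_local pE.
have e30 : 0 < e / 3 by rewrite divr_gt0.
have [[A B] /= [[N _ AN] Bp] AB] := cvg_mdist _ e30 it.
have Bn : \forall q \near p, forall n : 'I_N,
    mdist (iter n (@Fmap R) p) (iter n (@Fmap R) q) < e / 3.
  refine (@filter_forall (P2 R) 'I_N (fun n => [set q |
    mdist (iter n (@Fmap R) p) (iter n (@Fmap R) q) < e / 3]) (nbhs p) _ _) => n.
  exact: (cvg_mdist _ e30 (in_ n)).
exists (B `&` [set q | forall n : 'I_N,
    mdist (iter n (@Fmap R) p) (iter n (@Fmap R) q) < e / 3]); first exact: filterI.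
move=> n; apply: (@le_lt_trans _ _ ((e / 3 + e / 3)%:E)%E); last by rewrite lte_fin; lra.
have [nN|Nn] := ltnP n N.
  apply: (@diam_le _ (iter n (@Fmap R) p)) => _ [q [[_ qn] _] <-].
  by have := qn (Ordinal nN); exact: ltW.
apply: (@diam_le _ (Fstar p)) => _ [q [[Bq _] _] <-].
by apply/ltW/(AB (n, q)); split => //=; exact: AN.
Qed.

Lemma iter_cvg_uniform (K : set (P2 R)) : compact K -> K `<=` ~` ext_indet R ->
  {uniform K, (fun n => iter n (@Fmap R)) @ \oo --> @Fstar R}.
Proof.
move=> /compact_near_coveringP Kc KE U /uniform_nbhs[E [entE sub]].
move: entE; rewrite -entourage_ballE => -[e /= e0 he].
have e20 : 0 < e / 2 by rewrite divr_gt0.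
have : \forall n \near \oo, K `<=` [set q | mdist (Fstar q) (iter n (@Fmap R) q) < e].
  apply: (Kc nat \oo (fun n q => mdist (Fstar q) (iter n (@Fmap R) q) < e)) => p Kp.
  have [it _ fs] := iter_local (KE _ Kp).
  have [[A B] /= [Aoo Bp] AB] := cvg_mdist _ e20 it.
  have Fp : \forall q \near p, mdist (Fstar p) (Fstar q) < e / 2 by exact: (cvg_mdist _ e20 fs).
  exists (B `&` [set q | mdist (Fstar p) (Fstar q) < e / 2], A).
    by split; [exact: (filterI Bp Fp)|exact: Aoo].
  move=> [q n] /= [[Bq Fq] An].
  have h2 : mdist (Fstar p) (iter n (@Fmap R) q) < e / 2 by exact: (AB (n, q) (conj An Bq)).
  rewrite metric_sym in Fq; rewrite [ltRHS](splitr e).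
  exact: (le_lt_trans (metric_triangle (Fstar q) (Fstar p) (iter n (@Fmap R) q)) (ltrD Fq h2)).
apply: filterS => n Kn; apply: sub => q Kq.
have := Kn q Kq; rewrite /mkset.
have -> : (mdist (Fstar q) (iter n (@Fmap R) q) < e) =
  ball (Fstar q) e (iter n (@Fmap R) q) :> Prop by rewrite ballEmdist.
exact: (he (Fstar q, iter n (@Fmap R) q)).
Qed.

End FatouSetE.

(** * The action preserves the Bernoulli measure *)

Section MeasurePreserving.
Context {R : realType} (mu : probability boundary R).

Lemma cylinder_cons b s :
  cylinder (b :: s) = [set x : nat -> bool | x 0%N = b /\ cylinder s (shift x)].
Proof.
apply/seteqP; split=> x /=.
  by move=> h; split; [exact: (h 0%N)|move=> i si; exact: (h i.+1)].
by move=> [h0 h] [|i] si //; exact: h.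
Qed.

Lemma cylinder_inter s t : exists2 A, (range cylinder `|` [set set0]) A &
  cylinder s `&` cylinder t = A.
Proof.
have [->|/set0P[x [xs xt]]] := eqVneq (cylinder s `&` cylinder t) set0.
  by exists set0 => //; right.
wlog st : s t xs xt / (size s <= size t)%N.
  move=> H; have [st|/ltnW ts] := leqP (size s) (size t); first exact: H.
  by rewrite setIC; exact: H.
exists (cylinder t); first by left; exists t.
apply: setIidr => y yt i si.
by rewrite yt ?(leq_trans si)// -(xt i) ?(leq_trans si)// xs.
Qed.

Lemma measurable_cylinder s : measurable (cylinder s : set boundary).
Proof. by apply: sub_sigma_algebra; exists s. Qed.

Definition mpreserving (phi : boundary -> boundary) := measurable_fun setT phi /\
  forall A, measurable A -> mu (phi @^-1` A) = mu A.

(** Cylinders generate the sigma-algebra and, with the empty set, are closed under intersections;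
their measure depends only on their length. *)
Lemma mpreserving_cylinder (phi : boundary -> boundary) : uniform_bernoulli mu ->
  (forall s, exists2 t, size t = size s & phi @^-1` (cylinder s) = cylinder t) ->
  mpreserving phi.
Proof.
move=> muB H.
have mphi : measurable_fun setT phi.
  apply: (@measurability _ _ boundary boundary setT phi (range cylinder)) => //.
  move=> _ [_ [s _ <-] <-]; rewrite setTI; have [t _ ->] := H s.
  exact: measurable_cylinder.
split => // A mA.
pose phim : {mfun boundary >-> boundary} := HB.pack phi
  (@isMeasurableFun.Build _ _ _ _ phi mphi).
apply: (@g_sigma_algebra_measure_unique _ R boundary (range cylinder `|` [set set0]) _
  (fun=> setT) _ _ (pushforward mu phim) mu) => //.
- move=> B [[s _ <-]|->]; [exact: measurable_cylinder|exact: measurable0].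
- by move=> _; left; exists [::] => //; apply/seteqP; split.
- by rewrite bigcup_const.
- move=> B D [[s _ <-]|->] [[t _ <-]|->]; rewrite ?(set0I, setI0); try by right.
  by have [E EG ->] := cylinder_inter s t.
- move=> B [[s _ <-]|->]; last by rewrite !measure0.
  have [t ts tE] := H s.
  have ms : mu (phi @^-1` cylinder s) = mu (cylinder s).
    by rewrite tE; apply: (etrans (muB t)); rewrite ts; exact: (esym (muB s)).
  exact: ms.
- move=> _; have e1 : mu (phi @^-1` setT) = 1%E by rewrite preimage_setT probability_setT.
  have : (mu (phi @^-1` setT) < +oo)%E by rewrite e1 (ltry (1 : R)).
  exact.
- apply: sub_sigma_algebra2 mA => B [s _ <-]; by left; exists s.
Qed.

Lemma preimage_act_a s : exists2 t, size t = size s &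
  act_a @^-1` (cylinder s) = cylinder t.
Proof.
case: s => [|b s]; first by exists [::] => //; apply/seteqP; split.
exists (~~ b :: s) => //; rewrite !cylinder_cons; apply/seteqP; split=> x /=.
  by move=> [<- h]; rewrite negbK.
by move=> [-> h]; rewrite negbK.
Qed.

Lemma shift_act_t x : shift (act_t x) = if x 0%N then act_t (shift x) else act_a (shift x).
Proof. by apply/funext => n; rewrite /shift /act_t /=; case: (x 0%N). Qed.

Lemma preimage_act_t s : exists2 t, size t = size s &
  act_t @^-1` (cylinder s) = cylinder t.
Proof.
elim: s => [|b s [t ts tE]]; first by exists [::] => //; apply/seteqP; split.
have [u us uE] := preimage_act_a s.
exists (b :: (if b then t else u)); first by case: b => /=; rewrite ?ts ?us.
rewrite !cylinder_cons; apply/seteqP; split=> x /=; rewrite shift_act_t.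
- by move=> [<-]; case: (x 0%N) => h; split=> //; [rewrite -tE|rewrite -uE].
- by move=> [->]; case: b => h; split=> //; [move: h; rewrite -tE|move: h; rewrite -uE].
Qed.

Lemma mpreserving_act_a : uniform_bernoulli mu -> mpreserving act_a.
Proof. by move=> muB; apply: mpreserving_cylinder muB preimage_act_a. Qed.

Lemma mpreserving_act_t : uniform_bernoulli mu -> mpreserving act_t.
Proof. by move=> muB; apply: mpreserving_cylinder muB preimage_act_t. Qed.

Lemma mpreserving_comp phi psi : mpreserving phi -> mpreserving psi -> mpreserving (phi \o psi).
Proof.
move=> [mphi phiE] [mpsi psiE]; split; first exact: measurableT_comp.
move=> A mA; rewrite comp_preimage psiE ?phiE// -[X in measurable X]setTI.
exact: mphi.
Qed.

Lemma mpreserving_id : mpreserving id.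
Proof. by split=> // A mA. Qed.

Lemma mpreserving_iter phi n : mpreserving phi -> mpreserving (iter n phi).
Proof.
by move=> mphi; elim: n => [|n IH]; [exact: mpreserving_id|exact: (mpreserving_comp mphi IH)].
Qed.

Lemma mpreserving_ae phi (P : boundary -> Prop) : mpreserving phi ->
  (\forall x \ae mu, P x) -> \forall x \ae mu, P (phi x).
Proof.
move=> [mphi phiE] [A [mA A0 PA]]; exists (phi @^-1` A); split.
- by rewrite -[X in measurable X]setTI; exact: mphi.
- by rewrite phiE.
- by move=> x Px; apply: PA.
Qed.

Lemma mpreserving_integral phi (f : boundary -> \bar R) : mpreserving phi ->
  measurable_fun setT f -> (forall x, (0 <= f x)%E) ->
  (\int[mu]_x f (phi x) = \int[mu]_x f x)%E.
Proof.
move=> [mphi phiE] mf f0.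
have := @ge0_integral_pushforward _ _ _ _ _ phi mphi mu setT f measurableT mf
  (fun x _ => f0 x).
rewrite preimage_setT => <-; apply: eq_measure_integral => A mA _.
exact: (phiE A mA).
Qed.

End MeasurePreserving.

(** * Square-integrable functions *)

Section SquareIntegrable.
Context {R : realType} (mu : probability boundary R).
Implicit Types (f g : boundary -> R[i]) (c : R[i]).

(** The squared modulus as a real number, and sqnorm below the squared norm of L^2: squares avoid
both the powers of the norm and the Minkowski inequality. *)
Definition modsq c : R := complex.Re c ^+ 2 + complex.Im c ^+ 2.

Lemma modsq_ge0 c : 0 <= modsq c.
Proof. by rewrite addr_ge0 ?sqr_ge0. Qed.

Lemma modsqE c : (modsq c)%:C%C = `|c| ^+ 2.
Proof. by rewrite add_Re2_Im2. Qed.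

Lemma modsqM c d : modsq (c * d) = modsq c * modsq d.
Proof. by apply/complexI; rewrite rmorphM/= !modsqE normrM exprMn. Qed.

Lemma modsq_eq0 c : (modsq c == 0) = (c == 0).
Proof. by rewrite -(inj_eq (@complexI R)) modsqE expf_eq0 normr_eq0. Qed.

Lemma modsq0 : modsq 0 = 0.
Proof. by apply/eqP; rewrite modsq_eq0. Qed.

Lemma modsqD_le c d : modsq (c + d) <= 2 * modsq c + 2 * modsq d.
Proof.
case: c d => [a b] [x y]; rewrite /modsq /=.
by have := sqr_ge0 (a - x); have := sqr_ge0 (b - y); rewrite !sqrrB !sqrrD; lra.
Qed.

Definition cmeasurable f := measurable_fun setT (fun x => complex.Re (f x)) /\
  measurable_fun setT (fun x => complex.Im (f x)).

Definition sqnorm f : \bar R := (\int[mu]_x (modsq (f x))%:E)%E.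

Lemma cmeasurable_modsq f : cmeasurable f -> measurable_fun setT (fun x => (modsq (f x))%:E).
Proof.
move=> [fr fi]; apply/measurable_EFinP; apply: measurable_funD; exact: measurable_funX.
Qed.

Lemma cmeasurableD f g : cmeasurable f -> cmeasurable g -> cmeasurable (fun x => f x + g x).
Proof.
move=> [fr fi] [gr gi]; split.
  rewrite (_ : (fun x => _) = (fun x => complex.Re (f x) + complex.Re (g x))).
    exact: measurable_funD.
  by apply/funext => x; case: (f x) (g x) => [? ?] [].
rewrite (_ : (fun x => _) = (fun x => complex.Im (f x) + complex.Im (g x))).
  exact: measurable_funD.
by apply/funext => x; case: (f x) (g x) => [? ?] [].
Qed.

Lemma cmeasurableZ c f : cmeasurable f -> cmeasurable (fun x => c * f x).
Proof.
move=> [fr fi]; split.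
  rewrite (_ : (fun x => _) = (fun x => complex.Re c * complex.Re (f x)
    - complex.Im c * complex.Im (f x))).
    by apply: measurable_funB; apply: measurable_funM => //; exact: measurable_cst.
  by apply/funext => x; case: (f x) c => [? ?] [].
rewrite (_ : (fun x => _) = (fun x => complex.Re c * complex.Im (f x)
    + complex.Im c * complex.Re (f x))).
  by apply: measurable_funD; apply: measurable_funM => //; exact: measurable_cst.
by apply/funext => x; case: (f x) c => [? ?] [].
Qed.

Lemma cmeasurable_comp phi f : measurable_fun setT phi -> cmeasurable f -> cmeasurable (f \o phi).
Proof.
move=> mphi [fr fi].
by split; [exact: (measurableT_comp fr)|exact: (measurableT_comp fi)].
Qed.

Lemma sqnorm_ge0 f : (0 <= sqnorm f)%E.
Proof. by apply: integral_ge0 => x _; rewrite lee_fin modsq_ge0. Qed.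

Lemma sqnormZ c f : cmeasurable f -> sqnorm (fun x => c * f x) = ((modsq c)%:E * sqnorm f)%E.
Proof.
move=> mf; rewrite /sqnorm -ge0_integralZl_EFin ?modsq_ge0//.
- by apply: eq_integral => x _; rewrite modsqM EFinM.
- by move=> x _; rewrite lee_fin modsq_ge0.
- exact: cmeasurable_modsq.
Qed.

Lemma sqnormD_le f g : cmeasurable f -> cmeasurable g ->
  (sqnorm (fun x => f x + g x)%R <= 2%:E * sqnorm f + 2%:E * sqnorm g)%E.
Proof.
move=> mf mg; rewrite /sqnorm -!ge0_integralZl_EFin//;
  try (by move=> x _; rewrite lee_fin modsq_ge0); try exact: cmeasurable_modsq.
rewrite -ge0_integralD//.
- apply: ge0_le_integral => //.
  + by move=> x _; rewrite lee_fin modsq_ge0.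
  + by apply: cmeasurable_modsq; exact: cmeasurableD.
  + by apply: emeasurable_funD; apply: measurable_funeM; exact: cmeasurable_modsq.
  + by move=> x _; rewrite -!EFinM -EFinD lee_fin modsqD_le.
- by move=> x _; rewrite -EFinM lee_fin mulr_ge0 ?modsq_ge0.
- by apply: measurable_funeM; exact: cmeasurable_modsq.
- by move=> x _; rewrite -EFinM lee_fin mulr_ge0 ?modsq_ge0.
- by apply: measurable_funeM; exact: cmeasurable_modsq.
Qed.

Lemma sqnorm_comp phi f : mpreserving mu phi -> cmeasurable f -> sqnorm (f \o phi) = sqnorm f.
Proof.
move=> mphi mf; apply: (mpreserving_integral (f := fun x => (modsq (f x))%:E)) => //.
  exact: cmeasurable_modsq.
by move=> x; rewrite lee_fin modsq_ge0.
Qed.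

Lemma sqnorm_ae f g : cmeasurable f -> cmeasurable g -> f = g %[ae mu] -> sqnorm f = sqnorm g.
Proof.
move=> mf mg fg; apply: ge0_ae_eq_integral => //; try exact: cmeasurable_modsq;
  try (by move=> x _; rewrite lee_fin modsq_ge0).
by apply: filterS fg => x fg xT; rewrite fg.
Qed.

Lemma sqnorm_eq0 f : cmeasurable f -> sqnorm f = 0%E -> f = (fun=> 0) %[ae mu].
Proof.
move=> mf f0.
have /ae_eq_integral_abs : measurable_fun setT (fun x => (modsq (f x))%:E).
  exact: cmeasurable_modsq.
move=> /(_ mu measurableT)[+ _]; rewrite (eq_integral (fun x => (modsq (f x))%:E)).
  move=> /(_ f0); apply: filterS => x /(_ I)/= [] /eqP.
  by rewrite modsq_eq0 => /eqP.
by move=> x _; rewrite abse_EFin ger0_norm// modsq_ge0.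
Qed.

Lemma Lfun2P (h : boundary -> R) : (h \in Lfun mu 2%:E) <->
  measurable_fun setT h /\ (\int[mu]_x ((h x) ^+ 2)%:E < +oo)%E.
Proof.
have E : (\int[mu]_x (`|(EFin \o h) x| `^ 2) = \int[mu]_x ((h x) ^+ 2)%:E)%E.
  apply: eq_integral => x _; rewrite /comp abse_EFin poweR_EFin powR_mulrn//.
  by rewrite real_normK ?num_real.
rewrite inE /=; split=> [/andP[]|[mh hoo]].
  rewrite !inE/= /finite_norm unlock E => mh hoo; split=> //.
  by apply: lty_poweRy hoo; rewrite invr_eq0.
apply/andP; rewrite !inE/=; split=> //.
by rewrite /finite_norm unlock E; exact: poweR_lty.
Qed.

Lemma L2P f : L2 mu f <-> cmeasurable f /\ (sqnorm f < +oo)%E.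
Proof.
have dec : cmeasurable f -> sqnorm f = (\int[mu]_x ((complex.Re (f x)) ^+ 2)%:E +
    \int[mu]_x ((complex.Im (f x)) ^+ 2)%:E)%E.
  move=> [fr fi]; rewrite /sqnorm -ge0_integralD//.
  - by move=> x _; rewrite lee_fin sqr_ge0.
  - by apply/measurable_EFinP; exact: measurable_funX.
  - by move=> x _; rewrite lee_fin sqr_ge0.
  - by apply/measurable_EFinP; exact: measurable_funX.
have ge0 (h : boundary -> R) : (0 <= \int[mu]_x ((h x) ^+ 2)%:E)%E.
  by apply: integral_ge0 => x _; rewrite lee_fin sqr_ge0.
split=> [[/Lfun2P[fr roo] /Lfun2P[fi ioo]]|[mf]].
  by have mf : cmeasurable f by []; split=> //; rewrite dec// lte_add_pinfty.
rewrite dec// => foo; case: (mf) => fr fi; split; apply/Lfun2P; split=> //.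
  by apply: le_lt_trans foo; rewrite leeDl.
by apply: le_lt_trans foo; rewrite leeDr.
Qed.

Lemma L2normE f : L2norm mu f = sqrte (sqnorm f).
Proof.
rewrite /L2norm unlock -poweR12_sqrt; last exact: sqnorm_ge0.
congr (_ `^ _)%E; apply: eq_integral => x _.
rewrite abse_EFin poweR_EFin powR_mulrn// real_normK ?num_real//.
by congr (_%:E); apply/complexI; rewrite modsqE normc_def -rmorphXn.
Qed.

Lemma boundedP (B : (boundary -> R[i]) -> boundary -> R[i]) :
  (exists M : R, forall f, L2 mu f -> (L2norm mu (B f) <= M%:E * L2norm mu f)%E) <->
  (exists2 K : R, 0 <= K & forall f, L2 mu f -> (sqnorm (B f) <= K%:E * sqnorm f)%E).
Proof.
split=> [[M HM]|[K K0 HK]].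
  exists (M ^+ 2); first exact: sqr_ge0.
  move=> f Lf; rewrite -lee_sqrt; last by rewrite mule_ge0 ?sqnorm_ge0// lee_fin sqr_ge0.
  rewrite sqrteM ?lee_fin ?sqr_ge0//= sqrtr_sqr -!L2normE.
  apply: le_trans (HM f Lf) _; apply: lee_wpmul2r; first by rewrite L2normE sqrte_ge0.
  by rewrite lee_fin ler_norm.
exists (Num.sqrt K) => f Lf; rewrite !L2normE.
rewrite -[(Num.sqrt K)%:E]/(sqrte K%:E) -sqrteM ?lee_fin// lee_sqrt ?HK//.
by rewrite mule_ge0 ?sqnorm_ge0.
Qed.

Lemma L2_cmeasurable f : L2 mu f -> cmeasurable f.
Proof. by case/L2P. Qed.

Lemma L2Z c f : L2 mu f -> L2 mu (fun x => c * f x).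
Proof.
move=> /L2P[mf foo]; apply/L2P; split; first exact: cmeasurableZ.
by rewrite sqnormZ// lte_mul_pinfty// lee_fin modsq_ge0.
Qed.

Lemma L2D f g : L2 mu f -> L2 mu g -> L2 mu (fun x => f x + g x).
Proof.
move=> /L2P[mf foo] /L2P[mg goo]; apply/L2P; split; first exact: cmeasurableD.
apply: le_lt_trans (sqnormD_le mf mg) _.
by apply: lte_add_pinfty; rewrite lte_mul_pinfty.
Qed.

Lemma L2_comp phi f : mpreserving mu phi -> L2 mu f -> L2 mu (f \o phi).
Proof.
move=> mphi /L2P[mf foo]; apply/L2P; split; last by rewrite sqnorm_comp.
by apply: cmeasurable_comp => //; case: mphi.
Qed.

End SquareIntegrable.

(** * Bounded and invertible operators *)

Section Operators.
Context {R : realType} (mu : probability boundary R).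
Implicit Types (f g : boundary -> R[i]) (c : R[i]).
Implicit Types (A B D : (boundary -> R[i]) -> boundary -> R[i]).
Local Notation bounded := (bounded_operator mu).

Lemma bounded_op_L2 B f : bounded B -> L2 mu f -> L2 mu (B f).
Proof. by case=> + _ _; apply. Qed.

(** A bounded operator maps almost everywhere vanishing functions to such functions; linearity does
the rest. *)
Lemma bounded_op_ae B f g : bounded B -> L2 mu f -> L2 mu g -> f = g %[ae mu] ->
  B f = B g %[ae mu].
Proof.
move=> [BL Blin /boundedP[K K0 BK]] Lf Lg fg.
pose h x := (-1) * f x + g x.
have Lh : L2 mu h by apply: L2D => //; exact: L2Z.
have h0 : sqnorm mu h = 0%E.
  rewrite (@sqnorm_ae _ _ h (fun=> 0)).
  - by rewrite /sqnorm integral0_eq// => x _; rewrite modsq0.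
  - exact: (L2_cmeasurable Lh).
  - by split; exact: measurable_cst.
  - by apply: filterS fg => x + _; rewrite /h mulN1r => -> //; rewrite addNr.
have Bh0 : sqnorm mu (B h) = 0%E.
  by apply/eqP; rewrite eq_le sqnorm_ge0 andbT (le_trans (BK h Lh))// h0 mule0.
have Bh : B h = (fun=> 0) %[ae mu] by apply: sqnorm_eq0 => //; exact: (L2_cmeasurable (BL h Lh)).
have := Blin (-1) f g Lf Lg; apply: filterS2 Bh => x Bh Bl _.
have := Bl I; rewrite -/h (Bh I) => /esym/eqP.
by rewrite mulN1r addrC subr_eq0 => /eqP.
Qed.

Lemma ae_trans f g h : f = g %[ae mu] -> g = h %[ae mu] -> f = h %[ae mu].
Proof. by apply: filterS2 => x fg gh xT; rewrite fg// gh. Qed.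

Lemma ae_sym f g : f = g %[ae mu] -> g = f %[ae mu].
Proof. by apply: filterS => x fg xT; rewrite fg. Qed.

Lemma ae_refl f : f = f %[ae mu].
Proof. by apply: nearW. Qed.

Lemma bounded_op_id : bounded (fun f => f).
Proof.
split=> //; first by move=> *; exact: ae_refl.
by apply/boundedP; exists 1 => // f _; rewrite mul1e.
Qed.

Lemma bounded_op_pull phi : mpreserving mu phi -> bounded (fun f => f \o phi).
Proof.
move=> mphi; split.
- by move=> f; exact: L2_comp.
- by move=> *; exact: ae_refl.
- by apply/boundedP; exists 1 => // f /L2_cmeasurable mf; rewrite mul1e sqnorm_comp.
Qed.

Lemma bounded_op_scale c A : bounded A -> bounded (fun f x => c * A f x).
Proof.
move=> [AL Alin /boundedP[K K0 AK]]; split.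
- by move=> f Lf; apply: L2Z; exact: AL.
- move=> d f g Lf Lg; have := Alin d f g Lf Lg; apply: filterS => x H xT.
  by rewrite H// mulrDr mulrCA.
- apply/boundedP; exists (modsq c * K); first by rewrite mulr_ge0 ?modsq_ge0.
  move=> f Lf; rewrite sqnormZ; last by apply: (L2_cmeasurable (AL _ Lf)).
  by rewrite EFinM -muleA lee_wpmul2l ?lee_fin ?modsq_ge0// AK.
Qed.

Lemma bounded_op_add A B : bounded A -> bounded B -> bounded (fun f x => A f x + B f x).
Proof.
move=> [AL Alin /boundedP[K K0 AK]] [BL Blin /boundedP[M M0 BM]]; split.
- by move=> f Lf; apply: L2D; [exact: AL|exact: BL].
- move=> d f g Lf Lg; have := Blin d f g Lf Lg; have := Alin d f g Lf Lg.
  apply: filterS2 => x HA HB xT.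
  by rewrite HA// HB// mulrDr addrACA.
- apply/boundedP; exists (2 * K + 2 * M); first by rewrite addr_ge0// mulr_ge0.
  move=> f Lf; have mA := L2_cmeasurable (AL _ Lf); have mB := L2_cmeasurable (BL _ Lf).
  apply: le_trans (sqnormD_le mu mA mB) _.
  have kE : ((2 * K + 2 * M)%:E * sqnorm mu f =
      2%:E * (K%:E * sqnorm mu f) + 2%:E * (M%:E * sqnorm mu f))%E.
    by rewrite !muleA -!EFinM -ge0_muleDl// lee_fin mulr_ge0.
  rewrite kE; apply: leeD; by rewrite lee_wpmul2l ?lee_fin// ?AK ?BM.
Qed.

Lemma bounded_op_comp A B : bounded A -> bounded B -> bounded (fun f => A (B f)).
Proof.
move=> bA bB; have [AL Alin /boundedP[K K0 AK]] := bA.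
have [BL Blin /boundedP[M M0 BM]] := bB; split.
- by move=> f Lf; apply: AL; exact: BL.
- move=> d f g Lf Lg; apply: (ae_trans _ (Alin d _ _ (BL _ Lf) (BL _ Lg))).
  apply: bounded_op_ae => //; first by apply: BL; apply: L2D => //; exact: L2Z.
    by apply: L2D; [apply: L2Z|]; exact: BL.
  exact: Blin.
- apply/boundedP; exists (K * M); first by rewrite mulr_ge0.
  move=> f Lf; apply: le_trans (AK _ (BL _ Lf)) _.
  by rewrite EFinM -muleA lee_wpmul2l ?lee_fin// BM.
Qed.

Lemma invertible_comp A B : bounded A -> bounded B -> invertible mu A -> invertible mu B ->
  invertible mu (fun f => A (B f)).
Proof.
move=> bA bB [A' bA' AA'] [B' bB' BB']; exists (fun f => B' (A' f)); first exact: bounded_op_comp.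
move=> f Lf; have LA'f := bounded_op_L2 bA' Lf; have LBf := bounded_op_L2 bB Lf.
split.
  apply: ae_trans (AA' f Lf).1; apply: bounded_op_ae => //; last by have [] := BB' _ LA'f.
  by apply: bounded_op_L2 => //; exact: bounded_op_L2.
apply: ae_trans (BB' f Lf).2; apply: bounded_op_ae => //; last by have [] := AA' _ LBf.
by apply: bounded_op_L2 => //; exact: bounded_op_L2.
Qed.

Lemma invertible_scale c : c != 0 -> invertible mu (fun f x => c * f x).
Proof.
move=> c0; exists (fun f x => c^-1 * f x); first by apply: bounded_op_scale; exact: bounded_op_id.
move=> f Lf; split; apply: nearW => x _; last by rewrite mulKf.
by rewrite mulVKf.
Qed.

(** If A divides the invertible operator D on both sides then it has the right inverse A' E and the
left inverse E A', where E inverts D; these agree. *)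
Lemma invertible_factor A A' D : bounded A -> bounded A' -> bounded D -> invertible mu D ->
  (forall f, L2 mu f -> A (A' f) = D f %[ae mu] /\ A' (A f) = D f %[ae mu]) ->
  invertible mu A.
Proof.
move=> bA bA' bD [E bE DE] AD; exists (fun f => A' (E f)); first exact: bounded_op_comp.
have right f : L2 mu f -> A (A' (E f)) = f %[ae mu].
  move=> Lf; have LE := bounded_op_L2 bE Lf.
  exact: ae_trans (AD _ LE).1 (DE _ Lf).1.
have left f : L2 mu f -> E (A' (A f)) = f %[ae mu].
  move=> Lf; apply: ae_trans (DE _ Lf).2; apply: bounded_op_ae => //; last exact: (AD _ Lf).2.
    by apply: (bounded_op_L2 bA'); exact: (bounded_op_L2 bA).
  exact: (bounded_op_L2 bD).
move=> f Lf; split; first exact: right.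
(* Both sides have the same image under A, which has the left inverse E A'. *)
have LAf := bounded_op_L2 bA Lf; have Lg := bounded_op_L2 bA' (bounded_op_L2 bE LAf).
apply: ae_trans (left _ Lf); apply: ae_trans (ae_sym (left _ Lg)) _.
apply: bounded_op_ae => //; try by do 2 apply: bounded_op_L2 => //.
by apply: bounded_op_ae => //; [exact: bounded_op_L2|exact: right].
Qed.

End Operators.

(** * Neumann series of a measure-preserving map *)

Lemma kcvg_unique (K : numFieldType) (f : nat -> K^o) (a b : K^o) :
  f @ \oo --> a -> f @ \oo --> b -> a = b.
Proof. exact: (cvg_unique (@norm_hausdorff K K^o)). Qed.

Section Neumann.
Context {R : realType} (mu : probability boundary R).
Context (phi : boundary -> boundary) (mphi : mpreserving mu phi).
Context (s : R[i]) (s1 : `|s| < 1).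
Implicit Types (f g : boundary -> R[i]) (c : R[i]).

Let r : R := complex.Re `|s|.

Let rE : r%:C%C = `|s|.
Proof. by rewrite /r normc_def. Qed.

Let r0 : 0 <= r.
Proof. by rewrite -ler0c rE normr_ge0. Qed.

Let r1 : r < 1.
Proof. by rewrite -ltcR rE. Qed.

Let modsq_s : modsq s = r ^+ 2.
Proof. by apply/complexI; rewrite modsqE rmorphXn/= rE. Qed.

Definition neumann_part f n x : R[i] := \sum_(0 <= k < n) s ^+ k * f (iter k phi x).

Definition neumann_weight f k x : R := r ^+ k * modsq (f (iter k phi x)).

(** Its integral is finite for square-integrable f, hence it is finite almost everywhere; where it
is finite the Neumann series converges absolutely. *)
Definition neumann_majorant f x : \bar R := (\sum_(0 <= k <oo) (neumann_weight f k x)%:E)%E.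

Lemma neumann_weight_ge0 f k x : 0 <= neumann_weight f k x.
Proof. by rewrite mulr_ge0 ?exprn_ge0 ?modsq_ge0. Qed.

Lemma neumann_majorant_ge0 f x : (0 <= neumann_majorant f x)%E.
Proof. by apply: nneseries_ge0 => k _ _; rewrite lee_fin neumann_weight_ge0. Qed.

Lemma neumann_partS f n x : neumann_part f n.+1 x = f x + s * neumann_part f n (phi x).
Proof.
rewrite /neumann_part big_nat_recl//= expr0 mul1r mulr_sumr; congr (_ + _).
by apply: eq_bigr => k _; rewrite exprS -mulrA -iterSr.
Qed.

(** Convexity of the square: a + s b is, up to a phase, the mean of a / (1 - r) and b with weights
1 - r and r. *)
Lemma modsq_convex (a b : R[i]) : modsq (a + s * b) <= modsq a / (1 - r) + r * modsq b.
Proof.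
have [A A0 AE] := normC_real a; have [B B0 BE] := normC_real b.
have aE : modsq a = A ^+ 2 by apply/complexI; rewrite modsqE AE rmorphXn.
have bE : modsq b = B ^+ 2 by apply/complexI; rewrite modsqE BE rmorphXn.
apply: (@le_trans _ _ ((A + r * B) ^+ 2)).
  rewrite -lecR modsqE rmorphXn/=; apply: lerXn2r; rewrite ?nnegrE ?normr_ge0//.
    by rewrite ler0c addr_ge0// mulr_ge0.
  apply: le_trans (ler_normD _ _) _; rewrite normrM AE BE -rE.
  by rewrite rmorphD rmorphM.
rewrite aE bE -subr_ge0.
have d0 : 0 < 1 - r by rewrite subr_gt0.
have -> : A ^+ 2 / (1 - r) + r * B ^+ 2 - (A + r * B) ^+ 2 =
    r / (1 - r) * (A - (1 - r) * B) ^+ 2.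
  by field; rewrite gt_eqF.
by rewrite mulr_ge0 ?sqr_ge0// divr_ge0// ltW.
Qed.

Lemma modsq_neumann_part f n x :
  modsq (neumann_part f n x) <= (\sum_(0 <= k < n) neumann_weight f k x) / (1 - r).
Proof.
elim: n x => [|n IH] x; first by rewrite /neumann_part !big_geq// modsq0 mul0r.
rewrite neumann_partS; apply: le_trans (modsq_convex _ _) _.
rewrite [leRHS](_ : _ =
    (modsq (f x) + \sum_(0 <= k < n) neumann_weight f k.+1 x) / (1 - r)); last first.
  by rewrite big_nat_recl//= /neumann_weight expr0 mul1r.
rewrite [leRHS]mulrDl lerD2l.
apply: le_trans (ler_wpM2l r0 (IH (phi x))) _.
rewrite mulrA mulr_sumr; rewrite le_eqVlt; apply/orP; left; apply/eqP.
congr (_ / _); apply: eq_bigr => k _; rewrite /neumann_weight exprS -mulrA.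
by rewrite -iterSr.
Qed.

Lemma sum_neumann_weight_le f n x : (neumann_majorant f x < +oo)%E ->
  \sum_(0 <= k < n) neumann_weight f k x <= fine (neumann_majorant f x).
Proof.
move=> foo; rewrite -lee_fin fineK ?ge0_fin_numE ?neumann_majorant_ge0// -sumEFin.
by apply: nneseries_lim_ge => k _ _; rewrite lee_fin neumann_weight_ge0.
Qed.

(** The series is dominated by that of r^k (1 + |f_k|^2), as |f_k| <= 1 + |f_k|^2. *)
Lemma cvg_dominated (h : nat -> R) f x : (neumann_majorant f x < +oo)%E ->
  (forall k, `|h k| <= r ^+ k * (1 + modsq (f (iter k phi x)))) -> cvgn (series h).
Proof.
move=> foo hh; apply: normed_cvg.
apply: (@series_le_cvg _ _ (fun k => r ^+ k * (1 + modsq (f (iter k phi x))))) => //.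
- by move=> k /=; rewrite normr_ge0.
- by move=> k; rewrite mulr_ge0 ?exprn_ge0// addr_ge0 ?modsq_ge0.
- have -> : (fun k => r ^+ k * (1 + modsq (f (iter k phi x)))) =
      (fun k => geometric 1 r k) + (fun k => neumann_weight f k x).
    by apply/funext => k; rewrite /= mulrDr mulr1 fctE /geometric /= mul1r.
  rewrite seriesD; apply: is_cvgD; first by apply: is_cvg_geometric_series; rewrite ger0_norm.
  apply: nondecreasing_is_cvgn.
    by apply: nondecreasing_series => k _ _; exact: neumann_weight_ge0.
  by exists (fine (neumann_majorant f x)) => _ [n _ <-]; exact: sum_neumann_weight_le.
Qed.

Lemma Re_sum (I : Type) (t : seq I) (F : I -> R[i]) :
  complex.Re (\sum_(i <- t) F i) = \sum_(i <- t) complex.Re (F i).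
Proof.
elim: t => [|i t IH]; rewrite ?big_nil// !big_cons -IH.
by case: (F i) (\sum_(_ <- _) _) => [? ?] [].
Qed.

Lemma Im_sum (I : Type) (t : seq I) (F : I -> R[i]) :
  complex.Im (\sum_(i <- t) F i) = \sum_(i <- t) complex.Im (F i).
Proof.
elim: t => [|i t IH]; rewrite ?big_nil// !big_cons -IH.
by case: (F i) (\sum_(_ <- _) _) => [? ?] [].
Qed.

Lemma nterm_le f k x (h : R) : h ^+ 2 <= modsq (s ^+ k * f (iter k phi x)) ->
  `|h| <= r ^+ k * (1 + modsq (f (iter k phi x))).
Proof.
move=> hh; apply: (@le_trans _ _ (r ^+ k * Num.sqrt (modsq (f (iter k phi x))))).
  rewrite -(@ler_pXn2r _ 2)// ?nnegrE ?mulr_ge0 ?exprn_ge0 ?sqrtr_ge0//.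
  rewrite real_normK ?num_real// (le_trans hh)// modsqM exprMn sqr_sqrtr ?modsq_ge0//.
  rewrite ler_wpM2r ?modsq_ge0// le_eqVlt; apply/orP; left; apply/eqP.
  by apply/complexI; rewrite modsqE normrX -rE -!rmorphXn.
rewrite ler_wpM2l ?exprn_ge0//.
move: (modsq _) (modsq_ge0 (f (iter k phi x))) => q q0.
have := sqr_ge0 (Num.sqrt q - 1); have := sqr_sqrtr q0; have := sqrtr_ge0 q.
by move: (Num.sqrt q) => t t0 <-; rewrite sqrrB; nra.
Qed.

Lemma neumann_part_cvgRe f x : (neumann_majorant f x < +oo)%E ->
  cvgn (fun n => complex.Re (neumann_part f n x)).
Proof.
move=> foo; have -> : (fun n => complex.Re (neumann_part f n x)) =
    series (fun k => complex.Re (s ^+ k * f (iter k phi x))).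
  by apply/funext => n; rewrite /neumann_part Re_sum.
apply: (cvg_dominated foo) => k; apply: nterm_le.
by rewrite /modsq lerDl sqr_ge0.
Qed.

Lemma neumann_part_cvgIm f x : (neumann_majorant f x < +oo)%E ->
  cvgn (fun n => complex.Im (neumann_part f n x)).
Proof.
move=> foo; have -> : (fun n => complex.Im (neumann_part f n x)) =
    series (fun k => complex.Im (s ^+ k * f (iter k phi x))).
  by apply/funext => n; rewrite /neumann_part Im_sum.
apply: (cvg_dominated foo) => k; apply: nterm_le.
by rewrite /modsq lerDr sqr_ge0.
Qed.

(** The value 0 where the majorant is infinite makes the operator send measurable functions to
measurable ones. *)
Definition neumann f x : R[i] := if (neumann_majorant f x < +oo)%E then
  (limn (fun n => complex.Re (neumann_part f n x)) +i*
   limn (fun n => complex.Im (neumann_part f n x)))%C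
  else 0.

Lemma neumann_cvg f x : (neumann_majorant f x < +oo)%E ->
  (fun n => complex.Re (neumann_part f n x)) @ \oo --> complex.Re (neumann f x) /\
  (fun n => complex.Im (neumann_part f n x)) @ \oo --> complex.Im (neumann f x).
Proof.
by move=> foo; rewrite /neumann foo; split; [exact: neumann_part_cvgRe|exact: neumann_part_cvgIm].
Qed.

Lemma neumann_cvgC f x : (neumann_majorant f x < +oo)%E ->
  (fun n => neumann_part f n x : R[i]^o) @ \oo --> (neumann f x : R[i]^o).
Proof.
move=> foo; have [lr li] := neumann_cvg foo.
have E (y : R[i]) : (complex.Re y +i* complex.Im y)%C = y by case: y.
rewrite -(E (neumann f x)); under eq_fun do rewrite -(E (neumann_part f _ x)).
exact: (cvg_Complex _ lr li).
Qed.

Lemma neumann_lim f x (y : R[i]) : (neumann_majorant f x < +oo)%E ->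
  (fun n => neumann_part f n x : R[i]^o) @ \oo --> (y : R[i]^o) -> neumann f x = y.
Proof. by move=> /neumann_cvgC fx fy; exact: (kcvg_unique fx fy). Qed.

(** The bound for partial sums passes to the limit; integrated, it shows that the operator is
bounded. *)
Lemma modsq_neumann f x : ((modsq (neumann f x))%:E <= (1 - r)^-1%:E * neumann_majorant f x)%E.
Proof.
have d0 : 0 < 1 - r by rewrite subr_gt0.
have [foo|foo] := boolP (neumann_majorant f x < +oo)%E; last first.
  by rewrite /neumann (negbTE foo) modsq0 mule_ge0 ?neumann_majorant_ge0// lee_fin invr_ge0 ltW.
rewrite -[neumann_majorant f x]fineK ?ge0_fin_numE ?neumann_majorant_ge0// -EFinM lee_fin.
have [lr li] := neumann_cvg foo.
have lim : (fun n => modsq (neumann_part f n x)) @ \oo --> modsq (neumann f x).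
  exact: (@kcvgD R _ _ _ _ _ _ _ (kcvgX (n:=2) lr) (kcvgX (n:=2) li)).
apply: (cvgr_to_le lim); apply: nearW => n.
apply: (le_trans (modsq_neumann_part f n x)); rewrite [leLHS]mulrC; apply: ler_wpM2l.
  by rewrite invr_ge0 ltW.
exact: sum_neumann_weight_le.
Qed.

Lemma geo_sum_le n : \sum_(0 <= k < n) r ^+ k <= (1 - r)^-1.
Proof.
have d0 : 0 < 1 - r by rewrite subr_gt0.
rewrite -[leRHS]mul1r ler_pdivlMr//.
have -> : (\sum_(0 <= k < n) r ^+ k) * (1 - r) = 1 - r ^+ n.
  elim: n => [|n IH]; first by rewrite big_geq// mul0r expr0 subrr.
  by rewrite big_nat_recr//= mulrDl IH exprS; ring.
by rewrite lerBlDr lerDl exprn_ge0.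
Qed.

Lemma measurable_neumann_weight f k : cmeasurable f ->
  measurable_fun setT (fun x => (neumann_weight f k x)%:E).
Proof.
move=> mf; apply/measurable_EFinP; apply: measurable_funM; first exact: measurable_cst.
by have /measurable_EFinP := cmeasurable_modsq (cmeasurable_comp (mpreserving_iter k mphi).1 mf).
Qed.

Lemma measurable_neumann_majorant f : cmeasurable f -> measurable_fun setT (neumann_majorant f).
Proof.
move=> mf; apply: (@ge0_emeasurable_sum _ _ _ setT (fun k x => (neumann_weight f k x)%:E) xpredT).
  by move=> k x _ _; rewrite lee_fin neumann_weight_ge0.
by move=> k _; exact: measurable_neumann_weight.
Qed.

Lemma integral_neumann_majorant f : L2 mu f ->
  (\int[mu]_x neumann_majorant f x <= (1 - r)^-1%:E * sqnorm mu f)%E.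
Proof.
move=> Lf; have mf := L2_cmeasurable Lf.
rewrite /neumann_majorant integral_nneseries//; last 2 first.
- by move=> k; exact: measurable_neumann_weight.
- by move=> k x _; rewrite lee_fin neumann_weight_ge0.
have E k : (\int[mu]_x (neumann_weight f k x)%:E = (r ^+ k)%:E * sqnorm mu f)%E.
  rewrite -(sqnorm_comp (mpreserving_iter k mphi) mf) /sqnorm -ge0_integralZl_EFin ?exprn_ge0//.
  - by move=> x _; rewrite lee_fin modsq_ge0.
  - exact: (cmeasurable_modsq (cmeasurable_comp (mpreserving_iter k mphi).1 mf)).
under eq_eseriesr do rewrite E.
apply: lime_le.
  by apply: is_cvg_nneseries => k _ _; rewrite mule_ge0 ?sqnorm_ge0// lee_fin exprn_ge0.
apply: nearW => n; rewrite -ge0_sume_distrl; last by move=> k _; rewrite lee_fin exprn_ge0.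
by rewrite sumEFin lee_wpmul2r ?sqnorm_ge0// lee_fin geo_sum_le.
Qed.

Lemma neumann_majorant_ae f : L2 mu f -> \forall x \ae mu, (neumann_majorant f x < +oo)%E.
Proof.
move=> Lf; have mf := L2_cmeasurable Lf.
have : mu.-integrable setT (neumann_majorant f).
  apply/integrableP; split; first exact: measurable_neumann_majorant.
  rewrite (eq_integral (neumann_majorant f)); last first.
    by move=> x _; rewrite gee0_abs ?neumann_majorant_ge0.
  apply: le_lt_trans (integral_neumann_majorant Lf) _; case/L2P : Lf => _ foo.
  by rewrite lte_mul_pinfty// lee_fin invr_ge0 subr_ge0 ltW.
move/(integrable_ae measurableT); apply: filterS => x /(_ I).
by rewrite ge0_fin_numE ?neumann_majorant_ge0.
Qed.

Lemma cmeasurable_neumann_part f n : cmeasurable f -> cmeasurable (neumann_part f n).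
Proof.
move=> mf; elim: n => [|n IH].
  rewrite (_ : neumann_part f 0 = fun=> 0); first by split; exact: measurable_cst.
  by apply/funext => x; rewrite /neumann_part big_geq.
rewrite (_ : neumann_part f n.+1 = (fun x => neumann_part f n x + s ^+ n * (f \o iter n phi) x)).
  apply: cmeasurableD => //; apply: cmeasurableZ.
  exact: (cmeasurable_comp (mpreserving_iter n mphi).1 mf).
by apply/funext => x; rewrite /neumann_part big_nat_recr.
Qed.

Lemma measurable_good f : cmeasurable f ->
  measurable [set x : boundary | (neumann_majorant f x < +oo)%E].
Proof.
move=> mf; rewrite -[X in measurable X]setTI.
by apply: emeasurable_fun_infty_o => //; exact: measurable_neumann_majorant.
Qed.

Lemma cmeasurable_neumann f : cmeasurable f -> cmeasurable (neumann f).
Proof.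
move=> mf; pose G := [set x : boundary | (neumann_majorant f x < +oo)%E].
have mG : measurable G := measurable_good mf.
have GE x : \1_G x = (neumann_majorant f x < +oo)%E%:R :> R.
  rewrite indicE; have [foo|foo] := boolP (neumann_majorant f x < +oo)%E.
    by rewrite mem_set.
  by rewrite memNset// => /= h; rewrite h in foo.
split.
  apply: (@measurable_fun_cvg _ _ _ setT
    (fun n x => \1_G x * complex.Re (neumann_part f n x))) => [n|x _].
    apply: measurable_funM; [exact: measurable_indic|exact: (cmeasurable_neumann_part n mf).1].
  rewrite GE; have [foo|foo] := boolP (neumann_majorant f x < +oo)%E.
    by under eq_fun do rewrite mul1r; exact: (neumann_cvg foo).1.
  by rewrite /neumann (negbTE foo); under eq_fun do rewrite mul0r; exact: cvg_cst.
apply: (@measurable_fun_cvg _ _ _ setT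
  (fun n x => \1_G x * complex.Im (neumann_part f n x))) => [n|x _].
  apply: measurable_funM; [exact: measurable_indic|exact: (cmeasurable_neumann_part n mf).2].
rewrite GE; have [foo|foo] := boolP (neumann_majorant f x < +oo)%E.
  by under eq_fun do rewrite mul1r; exact: (neumann_cvg foo).2.
by rewrite /neumann (negbTE foo); under eq_fun do rewrite mul0r; exact: cvg_cst.
Qed.

Lemma sqnorm_neumann f : L2 mu f ->
  (sqnorm mu (neumann f) <= ((1 - r)^-1 * (1 - r)^-1)%:E * sqnorm mu f)%E.
Proof.
move=> Lf; have mf := L2_cmeasurable Lf.
have d0 : 0 <= (1 - r)^-1 by rewrite invr_ge0 subr_ge0 ltW.
apply: (@le_trans _ _ (\int[mu]_x ((1 - r)^-1%:E * neumann_majorant f x))%E).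
  apply: ge0_le_integral => //.
  - by move=> x _; rewrite lee_fin modsq_ge0.
  - exact: (cmeasurable_modsq (cmeasurable_neumann mf)).
  - by apply: measurable_funeM; exact: measurable_neumann_majorant.
  - by move=> x _; exact: modsq_neumann.
rewrite ge0_integralZl_EFin//; last 2 first.
- by move=> x _; exact: neumann_majorant_ge0.
- exact: measurable_neumann_majorant.
by rewrite EFinM -muleA lee_wpmul2l ?lee_fin//; exact: integral_neumann_majorant.
Qed.

Lemma L2_neumann f : L2 mu f -> L2 mu (neumann f).
Proof.
move=> Lf; apply/L2P; split; first exact: (cmeasurable_neumann (L2_cmeasurable Lf)).
apply: le_lt_trans (sqnorm_neumann Lf) _; case/L2P : Lf => _ foo.
by rewrite lte_mul_pinfty// lee_fin mulr_ge0// invr_ge0 subr_ge0 ltW.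
Qed.

Lemma neumann_linear c f g : L2 mu f -> L2 mu g ->
  neumann (fun x => c * f x + g x) = (fun x => c * neumann f x + neumann g x) %[ae mu].
Proof.
move=> Lf Lg; have Lh := L2D (L2Z c Lf) Lg.
have := neumann_majorant_ae Lh; have := neumann_majorant_ae Lg; have := neumann_majorant_ae Lf.
apply: filterS3 => x foo goo hoo _; apply: (neumann_lim hoo).
have -> : (fun n => neumann_part (fun x => c * f x + g x) n x : R[i]^o) =
    (fun n => c * neumann_part f n x + neumann_part g n x : R[i]^o).
  apply/funext => n; rewrite /neumann_part mulr_sumr -big_split/=.
  by apply: eq_bigr => k _; ring.
exact: (kcvgD (kcvgM (kcvg_cst (c : R[i]^o)) (neumann_cvgC foo)) (neumann_cvgC goo)).
Qed.

Lemma bounded_op_neumann : bounded_operator mu neumann.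
Proof.
split; [exact: L2_neumann|exact: neumann_linear|].
apply/boundedP; exists ((1 - r)^-1 * (1 - r)^-1); last exact: sqnorm_neumann.
by rewrite mulr_ge0// invr_ge0 subr_ge0 ltW.
Qed.

Lemma neumann_comp f : neumann (f \o phi) = neumann f \o phi.
Proof.
have E : neumann_part (f \o phi) = (fun n x => neumann_part f n (phi x)).
  by apply/funext => n; apply/funext => x; apply: eq_bigr => k _; rewrite /= -iterSr.
have T x : neumann_majorant (f \o phi) x = neumann_majorant f (phi x).
  by rewrite /neumann_majorant; apply: eq_eseriesr => k _; rewrite /neumann_weight -iterSr.
by apply/funext => x; rewrite /neumann T E.
Qed.

Lemma neumann_right f : L2 mu f -> (fun x => neumann f x - s * neumann f (phi x)) = f %[ae mu].
Proof.
move=> Lf; have := mpreserving_ae mphi (neumann_majorant_ae Lf); have := neumann_majorant_ae Lf.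
apply: filterS2 => x foo goo _.
have l1 : (fun n => neumann_part f n.+1 x : R[i]^o) @ \oo --> (neumann f x : R[i]^o).
  have := neumann_cvgC foo; rewrite -cvg_shiftS; exact.
have l2 : (fun n => neumann_part f n.+1 x : R[i]^o) @ \oo -->
    (f x + s * neumann f (phi x) : R[i]^o).
  under eq_fun do rewrite neumann_partS.
  exact: (kcvgD (kcvg_cst (f x : R[i]^o)) (kcvgM (kcvg_cst (s : R[i]^o)) (neumann_cvgC goo))).
have -> : neumann f x = f x + s * neumann f (phi x).
  by exact: (kcvg_unique l1 l2).
by rewrite addrK.
Qed.

(** The partial sums satisfy S_(n+1) f = f + s (S_n f) o phi, which gives the right inverse; for the
left one, the operator is linear and commutes with composition by phi. *)
Lemma invertible_neumann : invertible mu (fun f x => f x - s * f (phi x)).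
Proof.
exists neumann; first exact: bounded_op_neumann.
move=> f Lf; split; first exact: neumann_right.
have Lfp : L2 mu (f \o phi) := L2_comp mphi Lf.
have -> : (fun x => f x - s * f (phi x)) = (fun x => (- s) * (f \o phi) x + f x).
  by apply/funext => x /=; rewrite mulNr addrC.
apply: ae_trans (neumann_linear (- s) Lfp Lf) _; rewrite neumann_comp.
apply: ae_trans (neumann_right Lf); apply: nearW => x _ /=.
by rewrite mulNr addrC.
Qed.

End Neumann.

(** * The projective spectrum of the Koopman representation *)

Section KoopmanSpectrum.
Context {R : realType} (mu : probability boundary R).
Context (muB : uniform_bernoulli mu).
Implicit Types (f g : boundary -> R[i]) (z : 'rV[R[i]]_3) (s : R[i]).

Let ma : mpreserving mu act_a := mpreserving_act_a muB.
Let mt : mpreserving mu act_t := mpreserving_act_t muB.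

Lemma bounded_op_Api z : bounded_operator mu (Api z).
Proof.
apply: bounded_op_add; last by apply: bounded_op_scale; exact: (bounded_op_pull mt).
apply: bounded_op_add; apply: bounded_op_scale; first exact: bounded_op_id.
exact: (bounded_op_pull ma).
Qed.

(** Changing the signs of z1 and z2 gives A' = z0 - z1 a - z2 t, and A A' only involves u + u^-1. *)
Definition flip z : 'rV[R[i]]_3 := row3 (z 0 0) (- z 0 1) (- z 0 2).

Lemma Api_flip z f x : Api z (Api (flip z) f) x =
  qform z * f x - z 0 1 * z 0 2 * (f (act_t (act_a x)) + f (act_a (act_t x))).
Proof. by rewrite /Api /pi_a /pi_t /flip !row3E /= act_aK act_tK /qform; ring. Qed.

Lemma flip_Api z f x : Api (flip z) (Api z f) x =
  qform z * f x - z 0 1 * z 0 2 * (f (act_t (act_a x)) + f (act_a (act_t x))).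
Proof. by rewrite /Api /pi_a /pi_t /flip !row3E /= act_aK act_tK /qform; ring. Qed.

(** A A' = A' A = Q - z1 z2 (u + u^-1) = Q / (1 + s^2) (1 - s u) (1 - s u^-1). *)
Lemma Api_invertible z s : `|s| < 1 -> joukowski z s -> qform z != 0 -> invertible mu (Api z).
Proof.
move=> s1 zs q0.
have mta : mpreserving mu (act_t \o act_a) := mpreserving_comp mt ma.
have mat : mpreserving mu (act_a \o act_t) := mpreserving_comp ma mt.
have s20 : 1 + s ^+ 2 != 0 by rewrite addr_expr_neq0.
have bN phi : mpreserving mu phi -> bounded_operator mu (fun f x => f x - s * f (phi x)).
  move=> mphi; have -> : (fun (f : boundary -> R[i]) x => f x - s * f (phi x)) =
      (fun f x => f x + (- s) * (f \o phi) x).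
    by apply/funext => f; apply/funext => x; rewrite mulNr.
  by apply: bounded_op_add; [exact: bounded_op_id|apply: bounded_op_scale; exact: bounded_op_pull].
pose k := qform z / (1 + s ^+ 2).
have k0 : k != 0 by rewrite mulf_neq0// invr_eq0.
pose D1 (f : boundary -> R[i]) x := f x - s * f ((act_t \o act_a) x).
pose D2 (f : boundary -> R[i]) x := f x - s * f ((act_a \o act_t) x).
pose D (f : boundary -> R[i]) x := k * f x.
have bD : bounded_operator mu D by apply: bounded_op_scale; exact: bounded_op_id.
have bD12 : bounded_operator mu (fun f => D1 (D2 f)) by apply: bounded_op_comp; exact: bN.
have iD : invertible mu (fun f => D (D1 (D2 f))).
  apply: (invertible_comp bD bD12 (invertible_scale mu k0)).
  by apply: invertible_comp; [exact: bN|exact: bN|exact: invertible_neumann..].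
have bDD := bounded_op_comp bD bD12.
apply: (invertible_factor (bounded_op_Api z) (bounded_op_Api (flip z)) bDD iD) => f Lf.
have E x : D (D1 (D2 f)) x =
    qform z * f x - z 0 1 * z 0 2 * (f (act_t (act_a x)) + f (act_a (act_t x))).
  rewrite /D /D1 /D2 /= act_tK act_aK.
  have -> : z 0 1 * z 0 2 = s * qform z / (1 + s ^+ 2) by rewrite zs [RHS]mulrC mulKf.
  by rewrite /k; field.
by split; apply: nearW => x _; rewrite ?Api_flip ?flip_Api E.
Qed.

Lemma measurable_letter0 : measurable_fun setT (fun x : boundary => x 0%N).
Proof.
apply: (measurable_fun_bool true); rewrite setTI.
rewrite (_ : _ @^-1` _ = cylinder [:: true]); first exact: measurable_cylinder.
by apply/seteqP; split=> x /=; [move=> h [|i]|move=> /(_ 0%N isT)].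
Qed.

Lemma measurable_shift : measurable_fun setT (shift : boundary -> boundary).
Proof.
apply: (@measurability _ _ boundary boundary setT shift (range cylinder)) => //.
move=> _ [_ [s _ <-] <-]; rewrite setTI.
rewrite (_ : _ @^-1` _ = cylinder (true :: s) `|` cylinder (false :: s)).
  by apply: measurableU; exact: measurable_cylinder.
rewrite !cylinder_cons; apply/seteqP; split=> x /=; last by case=> -[].
by move=> h; case: (x 0%N); [left|right].
Qed.

Lemma cmeasurable_if (f g : boundary -> R[i]) : cmeasurable f -> cmeasurable g ->
  cmeasurable (fun x : boundary => if x 0%N then f x else g x).
Proof.
move=> [fr fi] [gr gi]; split.
  rewrite (_ : (fun x => _) = (fun x : boundary => if x 0%N then complex.Re (f x)
      else complex.Re (g x))); last by apply/funext => x; case: (x 0%N).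
  by apply: measurable_fun_ifT => //; exact: measurable_letter0.
rewrite (_ : (fun x => _) = (fun x : boundary => if x 0%N then complex.Im (f x)
    else complex.Im (g x))); last by apply/funext => x; case: (x 0%N).
by apply: measurable_fun_ifT => //; exact: measurable_letter0.
Qed.

(** By the self-similarity of the action u = at satisfies u^2 = (u^-1, u) on the two halves of the
boundary. An eigenfunction h for 1/s^2 therefore extends from the half 0w, where it is h(w), to
an eigenfunction for s, with value h(a w) / s at 1w. *)
Lemma eigenfunction n s : s ^+ (2 ^ n) = 1 -> exists v : boundary -> R[i],
  [/\ cmeasurable v, forall x, modsq (v x) = 1 & forall x, v (act_t (act_a x)) = s * v x].
Proof.
elim: n s => [|n IH] s.
  rewrite expr1 => ->; exists (fun=> 1); split.
  - by split; exact: measurable_cst.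
  - by move=> _; rewrite /modsq /= expr1n expr0n/= addr0.
  - by move=> x; rewrite mul1r.
move=> sn; have s1 : `|s| = 1.
  apply/eqP; rewrite -(@pexpr_eq1 _ _ (2 ^ n.+1)) ?expn_gt0// -normrX sn normr1 //.
have s0 : s != 0 by rewrite -normr_eq0 s1 oner_eq0.
have [h [mh h1 hE]] : exists v : boundary -> R[i], [/\ cmeasurable v, forall x, modsq (v x) = 1 &
    forall x, v (act_t (act_a x)) = (s ^+ 2)^-1 * v x].
  by apply: IH; rewrite exprVn -exprM -expnS sn invr1.
exists (fun x => if x 0%N then s^-1 * h (act_a (shift x)) else h (shift x)); split.
- apply: cmeasurable_if; last exact: (cmeasurable_comp measurable_shift mh).
  apply: cmeasurableZ; apply: (cmeasurable_comp (phi := act_a \o shift)) mh.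
  exact: (measurableT_comp ma.1 measurable_shift).
- move=> x; case: (x 0%N); rewrite ?modsqM ?h1// mulr1.
  by apply/complexI; rewrite modsqE normfV s1 invr1 expr1n.
- move=> x; rewrite shift_act_t /=; case: (x 0%N) => /=.
    by rewrite mulrA mulfV// mul1r.
  have := hE (act_a (act_t (shift x))); rewrite act_aK act_tK => ->.
  by field.
Qed.

End KoopmanSpectrum.

Section NotInvertible.
Context {R : realType} (mu : probability boundary R).
Context (muB : uniform_bernoulli mu).
Implicit Types (f g : boundary -> R[i]) (z : 'rV[R[i]]_3) (s t : R[i]).

Let ma : mpreserving mu act_a := mpreserving_act_a muB.
Let mt : mpreserving mu act_t := mpreserving_act_t muB.

Lemma modsq_circle t : `|t| = 1 -> modsq (t - t^-1) <= 4.
Proof.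
move=> t1; have n1 u : `|u| = 1 -> modsq u = 1 :> R.
  by move=> u1; apply/complexI; rewrite modsqE u1 expr1n.
apply: le_trans (modsqD_le _ _) _; rewrite n1//.
by rewrite n1 ?normrN ?normfV ?t1 ?invr1//; lra.
Qed.

(** Take an eigenfunction v for t. Then A (A' v) = d v with d = Q - z1 z2 (t + 1/t), so g = A' v has
norm at most the norm of the inverse times |d|. As u g - g / t = z0 (t - 1/t) v, the product
|z0| |t - 1/t| is of the order of |d| too. But A v = 2 z0 v - g cannot be small. *)
Lemma invertible_estimate z : invertible mu (Api z) -> exists2 C : R, 0 <= C &
  forall n t, t ^+ (2 ^ n) = 1 ->
    modsq (t - t^-1) <= C * modsq (qform z - z 0 1 * z 0 2 * (t + t^-1)).
Proof.
move=> [B bB BA]; have [BL _ /boundedP[K K0 BK]] := bB.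
exists (40 * K ^+ 2); first by rewrite mulr_ge0 ?sqr_ge0.
move=> n t tn; have [v [mv v1 vE]] := @eigenfunction R mu muB n t tn.
have t1 : `|t| = 1.
  by apply/eqP; rewrite -(@pexpr_eq1 _ _ (2 ^ n)) ?expn_gt0// -normrX tn normr1.
have t0 : t != 0 by rewrite -normr_eq0 t1 oner_eq0.
have nt1 : modsq t^-1 = 1 by apply/complexI; rewrite modsqE normfV t1 invr1 expr1n.
have sqnormv : sqnorm mu v = 1%E.
  rewrite /sqnorm (eq_integral (cst 1%E)); last by move=> x _; rewrite v1.
  by rewrite integral_cst// mul1e; exact: probability_setT.
have Lv : L2 mu v by apply/L2P; split=> //; rewrite sqnormv ltry.
have vat x : v (act_a (act_t x)) = t^-1 * v x.
  have := vE (act_a (act_t x)); rewrite act_aK act_tK => ->.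
  by rewrite mulrA mulVf// mul1r.
pose g := Api (flip z) v.
have Lg : L2 mu g := bounded_op_L2 (bounded_op_Api muB (flip z)) Lv.
have mg := L2_cmeasurable Lg.
pose d := qform z - z 0 1 * z 0 2 * (t + t^-1).
have Ag : Api z g = (fun x => d * v x).
  by apply/funext => x; rewrite Api_flip vE vat /d; ring.
have Ng : (sqnorm mu g <= (K * modsq d)%:E)%E.
  have Bg := (BA g Lg).2.
  have LBg : L2 mu (B (Api z g)) := BL _ (bounded_op_L2 (bounded_op_Api muB z) Lg).
  rewrite -(sqnorm_ae (L2_cmeasurable LBg) mg Bg).
  apply: le_trans (BK _ (bounded_op_L2 (bounded_op_Api muB z) Lg)) _.
  by rewrite Ag sqnormZ// sqnormv mule1 EFinM.
have gE x : g x = z 0 0 * v x - (z 0 1 + z 0 2 * t) * v (act_a x).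
  have vt : v (act_t x) = t * v (act_a x) by rewrite -vE act_aK.
  by rewrite /g /Api /pi_a /pi_t /flip !row3E /= vt; ring.
have gu x : z 0 0 * (t - t^-1) * v x =
    (g \o (act_t \o act_a)) x + (- t^-1) * g x.
  rewrite /= !gE vE vat; have -> : v x = v (act_a (act_a x)) by rewrite act_aK.
  by field.
have [G G0 GE] : exists2 G : R, 0 <= G & sqnorm mu g = G%:E.
  have gfin : sqnorm mu g \is a fin_num.
    by rewrite ge0_fin_numE ?sqnorm_ge0//; case/L2P : Lg.
  exists (fine (sqnorm mu g)); last by rewrite fineK.
  by rewrite fine_ge0// sqnorm_ge0.
rewrite GE lee_fin in Ng.
have z0t : modsq (z 0 0) * modsq (t - t^-1) <= 4 * G.
  rewrite -modsqM -lee_fin -[leLHS]mule1 -sqnormv -sqnormZ//.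
  rewrite (_ : (fun x => _) = (fun x => (g \o (act_t \o act_a)) x + (- t^-1) * g x)); last first.
    by apply/funext => x; exact: gu.
  have mta : mpreserving mu (act_t \o act_a) := mpreserving_comp mt ma.
  apply: le_trans (sqnormD_le mu (cmeasurable_comp mta.1 mg) (cmeasurableZ _ mg)) _.
  rewrite sqnorm_comp// sqnormZ// (_ : modsq (- t^-1) = 1); last first.
    by apply/complexI; rewrite modsqE normrN normfV t1 invr1 expr1n.
  by rewrite mul1e GE -!EFinM -EFinD lee_fin; lra.
have one : 1 <= K * (8 * modsq (z 0 0) + 2 * G).
  have Bv := (BA v Lv).2; have LAv := bounded_op_L2 (bounded_op_Api muB z) Lv.
  rewrite -lee_fin -[leLHS]sqnormv -(sqnorm_ae (L2_cmeasurable (BL _ LAv)) mv Bv).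
  apply: le_trans (BK _ LAv) _; rewrite EFinM lee_wpmul2l ?lee_fin//.
  have -> : Api z v = (fun x => 2 * z 0 0 * v x + (-1) * g x).
    apply/funext => x; rewrite /g /Api /pi_a /pi_t /flip !row3E /=; ring.
  apply: le_trans (sqnormD_le mu (cmeasurableZ _ mv) (cmeasurableZ _ mg)) _.
  rewrite !sqnormZ// sqnormv GE mule1 -!EFinM -EFinD lee_fin modsqM.
  have -> : modsq (2 : R[i]) = 4 by rewrite /modsq /=; ring.
  have -> : modsq (-1 : R[i]) = 1 by rewrite /modsq /=; ring.
  by lra.
have := modsq_circle t1; have := modsq_ge0 (t - t^-1).
have := modsq_ge0 d; have := modsq_ge0 (z 0 0).
move: one z0t Ng; rewrite -/d.
move: (modsq d) (modsq (z 0 0)) (modsq (t - t^-1)) => D Z S one z0t Ng Z0 D0 S0 S4.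
have h1 : S <= K * (8 * (Z * S) + 2 * G * S).
  rewrite -[leLHS]mul1r; apply: le_trans (ler_wpM2r S0 one) _.
  by rewrite le_eqVlt; apply/orP; left; apply/eqP; ring.
apply: le_trans h1 _; rewrite (_ : 40 * K ^+ 2 * D = K * (40 * (K * D))); last by ring.
apply: ler_wpM2l => //.
have : G * S <= G * 4 by rewrite ler_wpM2l.
by rewrite -mulrA; lra.
Qed.

Lemma cvg_modsq (f : nat -> R[i]^o) (a : R[i]^o) : f @ \oo --> a ->
  (fun n => modsq (f n)) @ \oo --> modsq a.
Proof.
move=> fa.
have l2 : (fun n => `|f n| ^+ 2 : R[i]^o) @ \oo --> (`|a| ^+ 2 : R[i]^o).
  exact: (kcvgX (n:=2) (kcvg_norm fa)).
apply/cvgrPdistC_lt => e e0.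
have eC : 0 < e%:C%C :> R[i] by rewrite ltcR.
move/kcvgP : l2 => /(_ _ eC); apply: filterS => n; rewrite -!modsqE -rmorphB normc_def/=.
by rewrite expr0n/= addr0 sqrtr_sqr ltcR.
Qed.

(** By density of the dyadic roots of unity the estimate holds for all t on the unit circle, which
it cannot do near s. *)
Lemma Api_not_invertible z s : `|s| = 1 -> joukowski z s -> ~ invertible mu (Api z).
Proof.
move=> s1 zs /invertible_estimate[C0 C00 H0].
have s0 : s != 0 by rewrite -normr_eq0 s1 oner_eq0.
have qE : qform z = z 0 1 * z 0 2 * (s + s^-1).
  by apply: (mulfI s0); rewrite zs; field.
pose C := C0 * modsq (z 0 1 * z 0 2).
have C1 : 0 <= C by rewrite mulr_ge0 ?modsq_ge0.
have H t : `|t| = 1 -> modsq (t - t^-1) <= C * modsq (s + s^-1 - (t + t^-1)).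
  move=> t1; have t0 : t != 0 by rewrite -normr_eq0 t1 oner_eq0.
  have [u [un ut]] := roots_dense (oner_neq0 R[i]) t1.
  have uV : (fun n => (u n)^-1 : R[i]^o) @ \oo --> (t^-1 : R[i]^o) by exact: kcvgV.
  have l1 : (fun n => modsq (u n - (u n)^-1)) @ \oo --> modsq (t - t^-1).
    exact: (cvg_modsq (kcvgB ut uV)).
  have l2 : (fun n => modsq (s + s^-1 - (u n + (u n)^-1))) @ \oo --> modsq (s + s^-1 - (t + t^-1)).
    exact: (cvg_modsq (kcvgB (kcvg_cst (s + s^-1 : R[i]^o)) (kcvgD ut uV))).
  have l3 : (fun n => C * modsq (s + s^-1 - (u n + (u n)^-1))) @ \oo -->
      C * modsq (s + s^-1 - (t + t^-1)).
    exact: (@kcvgM R _ _ _ _ _ _ _ (kcvg_cst C) l2).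
  apply: (ler_cvg_to l1 l3); apply: nearW => n.
  have := H0 n (u n) (un n); rewrite qE -mulrBr modsqM mulrA; exact.
have [x [y [sE xy]]] : exists x y : R, s = (x +i* y)%C /\ x ^+ 2 + y ^+ 2 = 1.
  case: s s1 {s0 zs qE H} => x y; rewrite normc_def/= => -[] h; exists x, y; split=> //.
  by rewrite -[LHS]sqr_sqrtr ?addr_ge0 ?sqr_ge0// h expr1n.
have circ (a b : R) : a ^+ 2 + b ^+ 2 = 1 -> ((a +i* b)%C : R[i])^-1 = (a -i* b)%C.
  move=> ab; have ab1 : (a +i* b)%C * (a -i* b)%C = 1 :> R[i].
    by apply/eqP; rewrite eq_complex /=; apply/andP; split; apply/eqP; rewrite -?ab; ring.
  have ab0 : (a +i* b)%C != 0 :> R[i].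
    by apply: contra_eq_neq ab1 => ->; rewrite mul0r eq_sym oner_eq0.
  by apply: (mulfI ab0); rewrite mulfV.
(* Test the estimate at the point t = c + i w of the circle with c = x (1 - e), where
   x = Re s: as e -> 0 its left-hand side is of order at least e, its right-hand side of
   order e ^ 2, and e = 1 / (C + 1) is already too small. *)
pose e := (C + 1)^-1; pose c := x * (1 - e).
have Cp : 0 < C + 1 by rewrite ltr_wpDl.
have e0 : 0 < e by rewrite invr_gt0.
have e1 : e <= 1 by rewrite invf_le1// lerDr.
have eC : e * (C + 1) = 1 by rewrite mulVf// gt_eqF.
have x1 : x ^+ 2 <= 1 by rewrite -xy lerDl sqr_ge0.
have ce : c ^+ 2 <= (1 - e) ^+ 2.
  by rewrite exprMn ler_piMl// sqr_ge0.
have c1 : c ^+ 2 <= 1 by apply: le_trans ce _; rewrite exprn_ile1 ?subr_ge0// lerBlDr lerDl ltW.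
pose w := Num.sqrt (1 - c ^+ 2).
have cw : c ^+ 2 + w ^+ 2 = 1 by rewrite sqr_sqrtr ?subr_ge0// addrC subrK.
have t1 : `|(c +i* w)%C : R[i]| = 1 by rewrite normc_def/= cw sqrtr1.
have key : w ^+ 2 <= C * (x * e) ^+ 2.
  have := H _ t1; rewrite sE (circ _ _ xy) (circ _ _ cw) /modsq /=.
  have -> : (c - c) ^+ 2 + (w - - w) ^+ 2 = 4 * w ^+ 2 by ring.
  have -> : (x + x - (c + c)) ^+ 2 + (y - y - (w - w)) ^+ 2 = 4 * (x * e) ^+ 2.
    by rewrite /c; ring.
  by rewrite (mulrCA C) ler_pM2l.
have h1 : C * (x * e) ^+ 2 <= e * (e * C).
  rewrite exprMn; apply: (@le_trans _ _ (C * (1 * e ^+ 2))).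
    by apply: ler_wpM2l => //; apply: ler_wpM2r; rewrite ?sqr_ge0.
  by rewrite mul1r expr2 le_eqVlt; apply/orP; left; apply/eqP; ring.
have h2 : e * C = 1 - e by rewrite -eC mulrDr mulr1 addrK.
rewrite h2 in h1; move: cw ce e0 key h1; clear => cw ce e0 key h1.
have : (1 - e) ^+ 2 = 1 - 2 * e + e ^+ 2 by ring.
have : e * (1 - e) = e - e ^+ 2 by ring.
by lra.
Qed.

End NotInvertible.

(** * Fatou set and limit map *)

(** When Q = 0 and |s| < 1, the relation gives z1 z2 = 0, and then it also holds with s = 1. *)
Lemma resolvent_joukowski (R : realType) (mu : probability boundary R) (p : P2 R) :
  uniform_bernoulli mu -> proj_resolvent mu p ->
  exists s, [/\ `|s| < 1, joukowski (coords p) s & qform (coords p) != 0].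
Proof.
move=> muB pr; have [[s s1 zs]|[s s1 zs]] := joukowski_dichotomy (coords p); last first.
  by case: pr; exact: (Api_not_invertible muB s1 zs).
exists s; split=> //; apply/eqP => q0; case: pr.
apply: (Api_not_invertible muB (normr1 _)); rewrite /joukowski q0 mulr0.
move/esym/eqP: zs; rewrite q0 mulr0 mulf_eq0 (negbTE (addr_expr_neq0 s1 _))//= => /eqP->.
by rewrite mulr0.
Qed.

Lemma not_ext_indet_resolvent (R : realType) (mu : probability boundary R) (p : P2 R) :
  uniform_bernoulli mu -> ~ ext_indet R p -> proj_resolvent mu p.
Proof.
move=> muB pE; have z0 := coords_neq0 p; rewrite -(proj_coords p) in pE.
have [s [s1 zs _]] := not_ext_indet z0 pE.
have q0 : qform (coords p) != 0.
  by apply: (joukowski_indet_qform z0 s1 zs) => /indet_in_infty/ext_indet_sub.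
by apply; exact: (Api_invertible muB s1 zs q0).
Qed.

Theorem corollary5p12 (R : realType) (mu : probability boundary R)
    (mu_bernoulli : uniform_bernoulli mu) :
  (* (a) *)
  Fatou R = proj_resolvent mu `\` ext_indet R /\
  (* (b) *)
  [/\ forall p, proj_resolvent mu p -> cvgn (fseq p : nat -> R[i]^o),
      forall p, Fatou R p -> Fstar_coords p != 0 &
      forall K : set (P2 R), compact K -> K `<=` Fatou R ->
        {uniform K, (fun n => iter n (@Fmap R)) @ \oo --> @Fstar R}].
Proof.
rewrite FatouE; split.
  apply/seteqP; split=> [p pE|p []//]; split=> //.
  exact: not_ext_indet_resolvent.
split; last exact: iter_cvg_uniform.
- move=> p /(resolvent_joukowski mu_bernoulli)[s [s1 zs q0]].
  apply/cvg_ex; exists s; rewrite -(proj_coords p).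
  exact: (fseq_cvg (coords_neq0 p) s1 zs q0).
- exact: Fstar_coords_neq0.
Qed.
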